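(* Let $\Omega\subset\mathbb{C}$ be a bounded domain whose boundary consists of $n$ disjoint Jordan curves, let $V_0,\dots,V_{n-1}$ be the connected components of $\hat{\mathbb{C}}\setminus\Omega$ with $\infty\in V_0$, let $\Omega_i=\hat{\mathbb{C}}\setminus V_i$, and let $\phi_i:\overline{D}\to\overline{\Omega_i}$ be Riemann mappings ($i=0,\dots,n-1$). Then the class $$S=\bigcap_{i=0}^{n-1}\bigcap_{k=1}^\infty E^{(i)}_k,\qquad E^{(i)}_k=\{f\in A(\Omega):\operatorname{Re}(f\circ\phi_i)\restriction_{\mathbb{T}}\in D_k\},$$ is a dense $G_\delta$ subset of $A(\Omega)$.
   Context: $D$ is the open unit disc, $\mathbb{T}=\partial D$. A Riemann mapping $\phi_i:\overline{D}\to\overline{\Omega_i}$ (closure in $\hat{\mathbb{C}}$) is a homeomorphism mapping $D$ conformally onto $\Omega_i$; note $\phi_i(\mathbb{T})=\partial V_i\subset\partial\Omega$. $A(\Omega)$ is the space of functions continuous on $\overline{\Omega}$ and holomorphic on $\Omega$, with the supremum norm on $\overline{\Omega}$. Functions on $\mathbb{T}$ are identified with $2\pi$-periodic functions on $\mathbb{R}$ via $y\mapsto e^{iy}$. For $k\in\mathbb{N}$, $D_k$ is the set of real continuous functions $u$ on $\mathbb{T}$ such that for every $\theta\in\mathbb{R}$ there exists $y\in(\theta,\theta+\frac1k)$ with $|u(y)-u(\theta)|>k|y-\theta|$. *)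

(* Defs.v *)
From HB Require Import structures.
From mathcomp Require Import all_boot all_order all_algebra.
From mathcomp Require Import all_classical all_reals all_analysis.
From mathcomp Require Import complex.
Import Order.TTheory GRing.Theory Num.Theory.
Import numFieldNormedType.Exports.

Set Implicit Arguments.
Unset Strict Implicit.
Unset Printing Implicit Defensive.

Local Open Scope classical_set_scope.
Local Open Scope ring_scope.

(* The complex plane C, with its usual (norm) topology, as a normed
   space over itself (so [derivable f z 1] is complex differentiability). *)
Definition Cx (R : realType) : Type := R[i].
HB.instance Definition _ (R : realType) := Num.ClosedField.on (Cx R).
HB.instance Definition _ (R : realType) := NormedModule.copy (Cx R) (Cx R)^o.

(* The Riemann sphere: one-point compactification of C, [None] = infinity. *)
Definition Chat (R : realType) : topologicalType :=
  one_point_compactification (Cx R).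

Section Defs.
Variable R : realType.
Local Notation C := (Cx R).

Definition cdisk : set C := [set z | `|z| <= 1].
Definition odisk : set C := [set z | `|z| < 1].
Definition circ : set C := [set z | `|z| = 1].

Definition expi (y : R) : C := (cos y +i* sin y)%C.

Definition bdry (A : set C) : set C := closure A `\` interior A.

Definition jordan_curve (J : set C) : Prop :=
  exists g : C -> C,
    [/\ {within circ, continuous g},
        (forall z w, circ z -> circ w -> g z = g w -> z = w) &
        J = g @` circ].

Definition holo_on (U : set C) (f : C -> C) : Prop :=
  forall z, U z -> derivable f z 1.

Definition algA (Om : set C) (f : C -> C) : Prop :=
  {within closure Om, continuous f} /\ holo_on Om f.

Definition embC (z : C) : Chat R := Some z.
Definition infty : Chat R := None.

Definition chat_inv (p : Chat R) : Chat R :=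
  match p with
  | None => Some 0
  | Some a => if a == 0 then None else Some a^-1
  end.

Definition holo_chat_at (phi : C -> Chat R) (z : C) : Prop :=
  exists h : C -> C,
    (\forall w \near z, derivable h w 1) /\
    ((\forall w \near z, phi w = Some (h w)) \/
     (\forall w \near z, phi w = chat_inv (Some (h w)))).

Definition riemann_map (O : set (Chat R)) (phi : C -> Chat R) : Prop :=
  [/\ {within cdisk, continuous phi},
      (forall z w, cdisk z -> cdisk w -> phi z = phi w -> z = w),
      phi @` cdisk = closure O &
      (exists psi : Chat R -> C,
          {within closure O, continuous psi} /\
          forall z, cdisk z -> psi (phi z) = z)] /\
  (phi @` odisk = O /\ forall z, odisk z -> holo_chat_at phi z).

(* value of f at a point of the sphere lying in C (junk 0 at infinity) *)
Definition fhat (f : C -> C) (p : Chat R) : C :=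
  if p is Some w then f w else 0.

Definition Dk (k : nat) (u : C -> R) : Prop :=
  {within circ, continuous u} /\
  forall theta : R, exists y : R,
    theta < y < theta + k%:R^-1 /\
    k%:R * `|y - theta| < `|u (expi y) - u (expi theta)|.

Definition Ek (phi : C -> Chat R) (k : nat) (f : C -> C) : Prop :=
  Dk k (fun z => complex.Re (fhat f (phi z))).

(* Topology of A(Omega) (sup norm on closure Omega), stated explicitly *)
Definition supdist_le (Om : set C) (f g : C -> C) (e : R) : Prop :=
  forall z, closure Om z -> `|f z - g z| <= (e%:C)%C.

Definition A_open (Om : set C) (U : set (C -> C)) : Prop :=
  forall f, algA Om f -> U f ->
    exists2 e : R, 0 < e &
      forall g, algA Om g -> supdist_le Om f g e -> U g.

Definition A_dense (Om : set C) (S : set (C -> C)) : Prop :=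
  forall f, algA Om f -> forall e : R, 0 < e ->
    exists g, [/\ algA Om g, S g & supdist_le Om f g e].

Definition A_Gdelta (Om : set C) (S : set (C -> C)) : Prop :=
  exists U : nat -> set (C -> C),
    (forall m, A_open Om (U m)) /\
    (forall f, algA Om f -> (S f <-> forall m, U m f)).

End Defs.

(* Main.v *)
Require Import Defs.
From HB Require Import structures.
From mathcomp Require Import all_boot all_order all_algebra.
From mathcomp Require Import all_classical all_reals all_analysis.
From mathcomp Require Import complex.
From mathcomp Require Import ring lra.
Import Order.TTheory GRing.Theory Num.Theory.
Import numFieldNormedType.Exports.
Local Open Scope classical_set_scope.
Local Open Scope ring_scope.

Set Implicit Arguments.
Unset Strict Implicit.
Unset Printing Implicit Defensive.

(** Write k_i for the inverse of the Riemann map phi_i, restricted to the closure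
    of Omega, where it is bounded by 1. On the i-th boundary curve Re (k_i^N) is
    cos (N t), so for f in A(Omega) and a > 0 the function f + a k_i^N lies in
    E_k^(i) as soon as N is large against the modulus of continuity of f: every
    E_k^(i) is dense. It is open by compactness of the circle. The Baire argument
    is run by hand: the limit f + sum_m a_m k_(i_m)^(N_m) is holomorphic because
    |k_i| <= r < 1 locally in Omega, which makes all powers k_i^N Lipschitz with the
    common constant 1 / (1 - r) relative to k_i.

    That k_i is holomorphic requires phi_i' <> 0. By Goursat's theorem on rectangles,
    in exponential coordinates, the mean over a circle of a function holomorphic in a
    punctured disc does not depend on the radius. Hence h'(a) is the mean of
    (h z - h a) / (z - a) over the circle of a fixed radius around a and, where it
    does not vanish, 1 / h'(a) is the mean of the inverse of that quotient; for
    injective h this excludes zeros of h'. *)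

(** * The modulus and complex differentiability *)

(** The perturbation a k_i^N costs at most a in the supremum norm whatever N is, so its size and its
    frequency can be chosen independently; this is what lets one function oscillate fast on a
    boundary curve and still be small on the whole domain. The obstacle is holomorphy, and it
    appears twice. A uniform limit of holomorphic functions is usually handled by Cauchy's formula;
    using only powers of finitely many fixed functions as perturbations replaces this by an
    elementary estimate on difference quotients at each point. Secondly, phi_i is given as a
    holomorphic injection with a continuous inverse, so the differentiability of the inverse has to
    be earned. Only the values of circle means are used for that, and these follow from Goursat's
    theorem by shrinking the circle, without power series. For i > 0 the domain Omega_i contains
    infinity and phi_i takes this value in the disc. The inverse is only ever evaluated at finite
    points, where a finite coordinate of phi_i can be chosen. *)

Section Modulus.
Variable R : realType.
Local Notation C := (Cx R).
Implicit Types (x y z w : C) (r e : R).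

(** The norm of [Cx R] has values in [Cx R] itself, which is only partially ordered. Its real part
    carries the same information in [R], where [lra] applies. *)
Definition cmod z : R := complex.Re `|z|.
Definition RtoC (r : R) : C := (r%:C)%C.

Lemma cmodE z : cmod z = Num.sqrt (complex.Re z ^+ 2 + complex.Im z ^+ 2).
Proof. by rewrite /cmod -[`|z|]/(`|z : R[i]|) normc_def. Qed.
Lemma normE z : `|z| = RtoC (cmod z).
Proof. by rewrite cmodE -[`|z|]/(`|z : R[i]|) normc_def. Qed.
Lemma RtoC_le r e : (RtoC r <= RtoC e) = (r <= e).
Proof. exact: lecR. Qed.
Lemma RtoC_lt r e : (RtoC r < RtoC e) = (r < e).
Proof. exact: ltcR. Qed.
Lemma RtoC_gt0 e : (0 < RtoC e) = (0 < e).
Proof. exact: (RtoC_lt 0). Qed.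
Lemma gt0_RtoC (z : C) : 0 < z -> exists2 e, 0 < e & z = RtoC e.
Proof.
move=> z0; exists (cmod z); rewrite -?RtoC_gt0 -normE ?gtr0_norm//.
Qed.
Lemma RtoC_inj : injective RtoC.
Proof. by move=> a b [] ->. Qed.
Lemma RtoCD r e : RtoC (r + e) = RtoC r + RtoC e. Proof. exact: rmorphD. Qed.
Lemma RtoCB r e : RtoC (r - e) = RtoC r - RtoC e. Proof. exact: rmorphB. Qed.
Lemma RtoCM r e : RtoC (r * e) = RtoC r * RtoC e. Proof. exact: rmorphM. Qed.
Lemma RtoC0 : RtoC 0 = 0. Proof. by []. Qed.
Lemma RtoC1 : RtoC 1 = 1. Proof. by []. Qed.

Lemma cmod_ge0 z : 0 <= cmod z.
Proof. by rewrite -RtoC_le -normE normr_ge0. Qed.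
Lemma cmod0 : cmod 0 = 0. Proof. by rewrite /cmod normr0. Qed.
Lemma cmod1 : cmod 1 = 1. Proof. by rewrite /cmod normr1. Qed.
Lemma cmodN z : cmod (- z) = cmod z. Proof. by rewrite /cmod normrN. Qed.
Lemma cmodB z w : cmod (z - w) = cmod (w - z). Proof. by rewrite /cmod distrC. Qed.
Lemma cmodM z w : cmod (z * w) = cmod z * cmod w.
Proof. by apply: RtoC_inj; rewrite RtoCM -!normE normrM. Qed.
Lemma cmodV z : cmod z^-1 = (cmod z)^-1.
Proof.
have [->|z0] := eqVneq z 0; first by rewrite invr0 cmod0 invr0.
have h : cmod z * cmod z^-1 = 1 by rewrite -cmodM divff// cmod1.
have c0 : cmod z != 0 by apply/eqP => c; move: h; rewrite c mul0r; lra.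
by apply: (mulfI c0); rewrite h divff.
Qed.
Lemma cmodX z n : cmod (z ^+ n) = cmod z ^+ n.
Proof. by elim: n => [|n ih]; rewrite ?expr0 ?cmod1// !exprS cmodM ih. Qed.
Lemma cmodD z w : cmod (z + w) <= cmod z + cmod w.
Proof. by rewrite -RtoC_le RtoCD -!normE ler_normD. Qed.
Lemma cmodD3 z x w : cmod (z - w) <= cmod (z - x) + cmod (x - w).
Proof. by rewrite (_ : z - w = (z - x) + (x - w)) ?cmodD// addrA subrK. Qed.
Lemma cmod_eq0 z : cmod z = 0 -> z = 0.
Proof. by move=> h; apply/eqP; rewrite -normr_eq0 normE h. Qed.
Lemma cmod_gt0 z : (0 < cmod z) = (z != 0).
Proof.
rewrite lt_neqAle cmod_ge0 andbT eq_sym; congr (~~ _).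
by apply/eqP/eqP => [/cmod_eq0//|->]; rewrite cmod0.
Qed.
Lemma cmodRtoC r : cmod (RtoC r) = `|r|.
Proof.
rewrite cmodE /= expr0n /= addr0 sqrtr_sqr//.
Qed.
Lemma cmod_Re z : `|complex.Re z| <= cmod z.
Proof.
rewrite -RtoC_le -normE; exact: normc_ge_Re.
Qed.
Lemma cmod_Im z : `|complex.Im z| <= cmod z.
Proof. rewrite cmodE -sqrtr_sqr ler_wsqrtr// lerDr sqr_ge0//. Qed.
Lemma cmod_ReIm z : cmod z <= `|complex.Re z| + `|complex.Im z|.
Proof.
rewrite cmodE -[leRHS]ger0_norm ?addr_ge0// -sqrtr_sqr ler_wsqrtr//.
rewrite sqrrD !real_normK ?num_real//.
have : 0 <= `|complex.Re z| * `|complex.Im z| by rewrite mulr_ge0. lra.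
Qed.

Lemma nbhs_cmod (z : C) (P : set C) :
  nbhs z P <-> exists2 e : R, 0 < e & forall w, cmod (w - z) < e -> P w.
Proof.
split.
  move=> /nbhs_ballP[e /= /gt0_RtoC[r r0 ->]] h; exists r => // w wz.
  apply: h; rewrite -ball_normE /ball_/= normE RtoC_lt cmodB//.
move=> [e e0 h]; apply/nbhs_ballP; exists (RtoC e); rewrite /= ?RtoC_gt0//.
by move=> w; rewrite -ball_normE /ball_/= normE RtoC_lt cmodB => /h.
Qed.

End Modulus.
Section CvgModulus.
Variable R : realType.
Local Notation C := (Cx R).

Lemma cvg_cmod (T : Type) (F : set_system T) {FF : Filter F} (f : T -> C) (l : C) :
  f @ F --> l <-> forall e : R, 0 < e -> \forall x \near F, cmod (f x - l) < e.
Proof.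
split.
  move=> h e e0; apply: (h [set w | cmod (w - l) < e]).
  by apply/nbhs_cmod; exists e.
move=> h P /nbhs_cmod[e e0 eP]; apply: filterS (h e e0) => x; exact: eP.
Qed.

End CvgModulus.

Section PointwiseContinuity.
Variables (R : realType) (T : topologicalType).
Local Notation C := (Cx R).
Implicit Types (f g : T -> C) (z : T).

(** The domain is an arbitrary topological space because the same calculus serves functions on the
    plane, curves on the real line and functions on a subspace. *)
Definition ccont f z :=
  forall e : R, 0 < e -> \forall w \near z, cmod (f w - f z) < e.

Lemma ccontP f z : {for z, continuous f} <-> ccont f z.
Proof. exact: (@cvg_cmod _ _ (nbhs z) _ f). Qed.

Lemma cvgC_cst z (c : C) : ccont (fun=> c) z.
Proof. by apply/ccontP; exact: cst_continuous. Qed.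

Lemma cvgCD f g z : ccont f z -> ccont g z ->
  ccont (fun w => f w + g w) z.
Proof.
move=> cf cg e e0.
have e2 : 0 < e / 2 by rewrite divr_gt0.
near=> w; rewrite opprD addrACA; apply: le_lt_trans (cmodD _ _) _.
have h1 : cmod (f w - f z) < e / 2 by near: w; exact: cf.
have h2 : cmod (g w - g z) < e / 2 by near: w; exact: cg.
lra.
Unshelve. all: by end_near. Qed.

Lemma cvgCM f g z : ccont f z -> ccont g z ->
  ccont (fun w => f w * g w) z.
Proof.
move=> cf cg e e0.
set M := cmod (f z) + cmod (g z) + 1.
have f0 := cmod_ge0 (f z); have g0 := cmod_ge0 (g z).
have M0 : 0 < M by rewrite /M; lra.
(* The cap at 1 bounds the product of the two increments by [e'], so that the three error terms add
   up to at most [e' * M <= e / 2]. *)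
set e' := Num.min 1 (e / (2 * M)).
have e'0 : 0 < e' by rewrite lt_min ltr01 divr_gt0// mulr_gt0.
have e'1 : e' <= 1 by rewrite ge_min lexx.
have e'M : e' * M <= e / 2.
  have : e' <= e / (2 * M) by rewrite ge_min lexx orbT.
  by rewrite ler_pdivlMr ?mulr_gt0//; lra.
near=> w.
have h1 : cmod (f w - f z) < e' by near: w; exact: cf.
have h2 : cmod (g w - g z) < e' by near: w; exact: cg.
have -> : f w * g w - f z * g z = (f w - f z) * (g w - g z) +
   ((f w - f z) * g z + f z * (g w - g z)) by ring.
apply: le_lt_trans (cmodD _ _) _; apply: le_lt_trans (lerD (lexx _) (cmodD _ _)) _.
rewrite !cmodM.
have k1 := cmod_ge0 (f w - f z); have k2 := cmod_ge0 (g w - g z).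
have p1 : cmod (f w - f z) * cmod (g w - g z) <= e' * 1.
  by apply: ler_pM => //; lra.
have p2 : cmod (f w - f z) * cmod (g z) <= e' * cmod (g z).
  by rewrite ler_wpM2r// ltW.
have p3 : cmod (f z) * cmod (g w - g z) <= cmod (f z) * e'.
  by rewrite ler_wpM2l// ltW.
have -> : e = e / 2 + e / 2 by lra.
by rewrite /M in e'M; lra.
Unshelve. all: by end_near. Qed.

Lemma cvgCN f z : ccont f z -> ccont (fun w => - f w) z.
Proof.
move=> cf e e0.
by apply: filterS (cf e e0) => w; rewrite -opprD cmodN.
Qed.

Lemma cvgCB f g z : ccont f z -> ccont g z ->
  ccont (fun w => f w - g w) z.
Proof. by move=> cf /cvgCN cg; exact: cvgCD cf cg. Qed.

Lemma cvgCV f z : f z != 0 -> ccont f z ->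
  ccont (fun w => (f w)^-1) z.
Proof. by move=> fz /ccontP cf; apply/ccontP; exact: (@cvgV _ _ (nbhs z) _ f). Qed.

End PointwiseContinuity.

Section Cdiff.
Variable R : realType.
Local Notation C := (Cx R).
Implicit Types (f g q : C -> C) (z d : C).

Lemma cvgC_id z : ccont id z.
Proof. by apply/ccontP; exact: cvg_id. Qed.

Lemma cvgC_comp (T : topologicalType) (h : T -> C) f (t : T) :
  ccont h t -> ccont f (h t) -> ccont (fun u => f (h u)) t.
Proof.
by move=> /ccontP ch /ccontP cf; apply/ccontP; exact: continuous_comp ch cf.
Qed.

Lemma ccont_cmod f z : ccont f z <->
  forall e : R, 0 < e -> exists2 d : R, 0 < d &
    forall w, cmod (w - z) < d -> cmod (f w - f z) < e.
Proof. by split=> h e /h/nbhs_cmod. Qed.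

Lemma ccont_near f g z : (\forall w \near z, f w = g w) -> ccont f z -> ccont g z.
Proof.
move=> fg cf e e0; have fgz : f z = g z by exact: nbhs_singleton fg.
by apply: filterS2 fg (cf e e0) => w -> ; rewrite fgz.
Qed.

(* Caratheodory's form of the derivative. *)
Definition cdiff f z d := exists q : C -> C,
  [/\ forall w, f w = f z + q w * (w - z), q z = d & ccont q z].

Lemma cdiff_id z : cdiff id z 1.
Proof. by exists (fun=> 1); split=> // [w|]; [rewrite mul1r subrKC|exact: cvgC_cst]. Qed.

Lemma cdiff_cst c z : cdiff (fun=> c) z 0.
Proof. by exists (fun=> 0); split=> // [w|]; [rewrite mul0r addr0|exact: cvgC_cst]. Qed.

Lemma cdiff_continuous f z d : cdiff f z d -> ccont f z.
Proof.
move=> [q [fq qz cq]].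
have -> : f = (fun w => f z + q w * (w - z)) by apply/funext => w.
exact: cvgCD (cvgC_cst z (f z)) (cvgCM cq (cvgCB (cvgC_id z) (cvgC_cst z z))).
Qed.

Lemma cdiffD f g z d e : cdiff f z d -> cdiff g z e ->
  cdiff (fun w => f w + g w) z (d + e).
Proof.
move=> [q [fq qz cq]] [p [gp pz cp]]; exists (fun w => q w + p w); split.
- by move=> w; rewrite fq gp; ring.
- by rewrite qz pz.
- exact: cvgCD cq cp.
Qed.

Lemma cdiffM f g z d e : cdiff f z d -> cdiff g z e ->
  cdiff (fun w => f w * g w) z (d * g z + f z * e).
Proof.
move=> df dg; have cg := cdiff_continuous dg.
move: df dg => [q [fq qz cq]] [p [gp pz cp]].
exists (fun w => q w * g w + f z * p w); split.
- move=> w; have e1 : q w * (w - z) = f w - f z by rewrite (fq w) addrAC subrr add0r.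
  have e2 : p w * (w - z) = g w - g z by rewrite (gp w) addrAC subrr add0r.
  rewrite (_ : (_ + _) * _ = q w * (w - z) * g w + f z * (p w * (w - z))).
    by rewrite e1 e2; ring.
  by ring.
- by rewrite qz pz.
- exact: cvgCD (cvgCM cq cg) (cvgCM (cvgC_cst _ _) cp).
Qed.

Lemma cdiffV f z d : f z != 0 -> cdiff f z d ->
  cdiff (fun w => (f w)^-1) z (- d / (f z) ^+ 2).
Proof.
move=> fz0 df; have cf := cdiff_continuous df; case: df => q [fq qz cq].
(* The identity for the slope is demanded at every [w], also where [f w = 0] and the inverse is 0 by
   convention. There the slope is obtained by solving the identity; near [z] this branch does not
   occur. *)
exists (fun w => if f w == 0 then - d / (f z) ^+ 2 +
    ((f w)^-1 - (f z)^-1 - (- d / (f z) ^+ 2) * (w - z)) / (w - z)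
  else - q w / (f w * f z)); split.
- move=> w; case: eqP => [fw|/eqP fw].
    have wz : w - z != 0.
      by apply/eqP => /subr0_eq wz; move: fz0; rewrite -wz fw eqxx.
    by rewrite fw invr0; field; rewrite wz fz0.
  have e1 : q w * (w - z) = f w - f z by rewrite (fq w) addrAC subrr add0r.
  rewrite (_ : _ * (w - z) = - (q w * (w - z)) / (f w * f z)).
    by rewrite e1; field; rewrite fw fz0.
  by field; rewrite fw fz0.
- by rewrite (negbTE fz0) qz expr2.
- have fz2 : f z * f z != 0 by rewrite mulf_neq0.
  have cd : ccont (fun w => f w * f z) z := cvgCM cf (cvgC_cst z (f z)).
  apply: ccont_near (cvgCM (cvgCN cq) (@cvgCV _ _ _ z fz2 cd)).
  have [e e0 h] : exists2 e : R, 0 < e & forall w, cmod (w - z) < e -> f w != 0.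
    have c0 : 0 < cmod (f z) by rewrite cmod_gt0.
    have [e e0 h] := (ccont_cmod f z).1 cf _ c0.
    exists e => // w /h; apply: contraTneq => ->.
    by rewrite sub0r cmodN ltxx.
  by apply/nbhs_cmod; exists e => // w /h /negbTE ->.
Qed.

Lemma cdiffX f z d n : cdiff f z d -> exists d', cdiff (fun w => f w ^+ n) z d'.
Proof.
move=> df; elim: n => [|n [d' ih]].
  by exists 0; exact: cdiff_cst.
exists (d * f z ^+ n + f z * d'); under [fun w => _]eq_fun do rewrite exprS.
exact: cdiffM.
Qed.

Lemma cdiff_near f g z d : (\forall w \near z, f w = g w) -> cdiff f z d ->
  cdiff g z d.
Proof.
move=> fg [q [fq qz cq]].
have fgz : f z = g z by exact: nbhs_singleton fg.
(* Away from [z], where the functions may differ, the slope is again read off from the identity that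
   it must satisfy. *)
exists (fun w => if f w == g w then q w else d + (g w - g z - d * (w - z)) / (w - z)); split.
- move=> w; case: eqP => [<-|/eqP fgw]; first by rewrite fq fgz.
  have wz : w - z != 0.
    by apply/eqP => /subr0_eq wz; move: fgw; rewrite wz fgz eqxx.
  by field.
- by rewrite fgz eqxx.
- by apply: ccont_near cq; apply: filterS fg => w ->; rewrite eqxx.
Qed.

Lemma cdiff_le f z d (e : R) : cdiff f z d -> 0 < e -> exists2 r : R, 0 < r &
  forall w, cmod (w - z) < r -> cmod (f w - f z - d * (w - z)) <= e * cmod (w - z).
Proof.
move=> [q [fq qz cq]] e0; have [r r0 h] := (ccont_cmod q z).1 cq e e0.
exists r => // w wr; rewrite [X in cmod X](_ : _ = (q w - q z) * (w - z)).
  by rewrite cmodM ler_wpM2r ?cmod_ge0// ltW// h.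
by rewrite fq qz; ring.
Qed.

Lemma le_cdiff f z d : (forall e : R, 0 < e -> exists2 r : R, 0 < r &
  forall w, cmod (w - z) < r -> cmod (f w - f z - d * (w - z)) <= e * cmod (w - z)) ->
  cdiff f z d.
Proof.
move=> h; exists (fun w => if w == z then d else (f w - f z) / (w - z)); split.
- move=> w; case: eqP => [->|/eqP wz]; first by rewrite subrr mulr0 addr0.
  by rewrite divfK ?subr_eq0// subrKC.
- by rewrite eqxx.
- apply/ccont_cmod => e e0.
  have [r r0 h'] := h (e / 2) ltac:(by rewrite divr_gt0).
  exists r => // w wr; rewrite eqxx; case: eqP => [_|/eqP wz].
    by rewrite subrr cmod0.
  have wz0 : 0 < cmod (w - z) by rewrite cmod_gt0 subr_eq0.
  rewrite -(ltr_pM2r wz0) -cmodM mulrBl divfK ?subr_eq0//.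
  by apply: le_lt_trans (h' w wr) _; rewrite ltr_pM2r//; lra.
Qed.

Lemma derivable_cdiff f z : derivable f z 1 <-> exists d, cdiff f z d.
Proof.
split.
  move=> /cvg_ex[/= l /(@cvg_cmod _ _ (0 : C)^') fl]; exists l; apply: le_cdiff => e e0.
  have := fl e e0; rewrite /dnbhs /within /=.
  move=> /nbhs_cmod[r r0 h]; exists r => // w wr.
  have [->|wz] := eqVneq w z; first by rewrite !subrr mulr0 subrr cmod0 mulr0.
  have := h (w - z); rewrite subr0 => /(_ wr); rewrite subr_eq0 => /(_ wz).
  have wz0 : w - z != 0 by rewrite subr_eq0.
  rewrite -[(w - z) *: 1]/((w - z) * 1) mulr1 subrK -[_ *: _]/((w - z)^-1 * (f w - f z)).
  move=> /ltW hh; rewrite -[f w - f z](mulVKf wz0) mulrC -mulrBl cmodM.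
  by rewrite ler_wpM2r ?cmod_ge0.
move=> [d [q [fq qz cq]]]; apply/cvg_ex; exists d; apply/(@cvg_cmod _ _ (0 : C)^') => e e0.
have [r r0 h] := (ccont_cmod q z).1 cq e e0.
rewrite /dnbhs; apply/nbhs_cmod; exists r => // w; rewrite subr0 => wr w0.
rewrite -[w *: 1]/(w * 1) mulr1 -[_ *: _]/(w^-1 * (f (w + z) - f z)).
rewrite fq addrK [f z + _]addrC addrK mulrC mulfK// -qz.
by apply: h; rewrite addrK.
Qed.

End Cdiff.

(** * Integrals as increments of primitives *)

Section Primitive.
Variable R : realType.
Implicit Types (u v P Q : R -> R) (a b : R).

Let mu := @lebesgue_measure R.

Lemma primitive_right u a : continuous u ->
  exists P : R -> R, forall x, a < x -> is_derive x 1 P (u x).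
Proof.
move=> cu; exists (fun x => (\int[mu]_(t in `[a, x]) u t)%R) => x ax.
have xx : x < x + 1 by rewrite ltrDl.
have iu : mu.-integrable `[a, x + 1] (EFin \o u).
  apply: continuous_compact_integrable; first exact: segment_compact.
  exact: continuous_subspaceT.
have [dF F'] := continuous_FTC1_closed xx iu ax (cu x).
by apply: DeriveDef; [exact: dF|rewrite -derive1E F'].
Qed.

Lemma primitive_left u a : continuous u ->
  exists P : R -> R, forall x, x < a -> is_derive x 1 P (u x).
Proof.
move=> cu; have cv : continuous (fun x => u (- x)).
  by move=> x; apply: continuous_comp; [exact: opp_continuous|exact: cu].
have [Q dQ] := primitive_right (- a) cv.
exists (fun x => - Q (- x)) => x xa.
have dQx : is_derive (- x) 1 Q (u x).
  by rewrite -{2}[x]opprK; apply: dQ; rewrite ltrN2.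
have dNx : is_derive x 1 (fun y : R => - y) (-1) by exact: is_deriveNid.
have := @is_derive1_comp R Q (fun y => - y) x _ _ dQx dNx.
move=> d; have := is_deriveN d; rewrite -mulN1r mulrCA mulN1r opprK mulr1.
by [].
Qed.

(** An integral from a base point gives a primitive to the right of it, and a reflection gives one
    to the left. On the overlap (-1, 1) the two differ by a constant, by the mean value theorem, so
    they can be glued once both are normalised to vanish at 0. *)
Lemma primitive_ex u : continuous u ->
  exists P : R -> R, forall x : R, is_derive x 1 P (u x).
Proof.
move=> cu; have [P dP] := primitive_right (-1) cu.
have [Q dQ] := primitive_left 1 cu.
have PQ (x : R) : -1 < x < 1 -> P x - P 0 = Q x - Q 0.
  move=> x1; pose D y := P y - Q y.
  have dD (y : R) : -1 < y < 1 -> is_derive y 1 D 0.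
    move=> /andP[y1 y2]; rewrite -(subrr (u y)).
    by apply: is_deriveB; [exact: dP|exact: dQ].
  have cst (a b : R) : -1 < a -> b < 1 -> a <= b -> D b - D a = 0.
    move=> a1 b1 ab; have [] := @MVT_segment R D (fun=> 0) a b ab.
    - by move=> y; rewrite in_itv/= => /andP[ay yb]; apply: dD; apply/andP; split; lra.
    - apply: derivable_within_continuous => y; rewrite in_itv/= => /andP[ay yb].
      by have [] : is_derive y 1 D 0 by apply: dD; apply/andP; split; lra.
    - by move=> c _ ->; rewrite mul0r.
  have [x0|x0] := leP x 0.
    have := cst x 0; rewrite /D; lra.
  have := cst 0 x; rewrite /D; lra.
exists (fun x => if 0 < x then P x - P 0 else Q x - Q 0) => x.
have dPx (y : R) : -1 < y -> is_derive y 1 (fun z => P z - P 0) (u y).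
  by move=> y1; rewrite -[u y]subr0; apply: is_deriveB; exact: dP.
have dQx (y : R) : y < 1 -> is_derive y 1 (fun z => Q z - Q 0) (u y).
  by move=> y1; rewrite -[u y]subr0; apply: is_deriveB; exact: dQ.
have [x0|x0] := ltP 0 x.
  apply: near_eq_is_derive (dPx x _); last by lra.
  by near=> y; rewrite ifT//; near: y; exact: lt_nbhsr.
apply: near_eq_is_derive (dQx x _); last by lra.
near=> y; case: ifPn => // y0; rewrite PQ//; apply/andP; split; first lra.
near: y; apply: lt_nbhsl; lra.
Unshelve. all: by end_near. Qed.

(** Integrating by increments of a chosen primitive makes additivity over intervals an identity for
    every [u]; for continuous [u], linearity follows from the uniqueness of primitives up to
    constants. The choice is arbitrary if [u] has no primitive. *)
Definition primitive u : R -> R := get [set P : R -> R | forall x : R, is_derive x 1 P (u x)].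

Definition rint u a b : R := primitive u b - primitive u a.

Lemma primitiveP u : continuous u -> forall x : R, is_derive x 1 (primitive u) (u x).
Proof.
move=> /primitive_ex[P dP].
by have := @getPex _ [set P : R -> R | forall x : R, is_derive x 1 P (u x)] (ex_intro _ P dP).
Qed.

Lemma rint_unique u Q a b : continuous u -> (forall x : R, is_derive x 1 Q (u x)) ->
  rint u a b = Q b - Q a.
Proof.
move=> /primitiveP dP dQ.
have D0 (x : R) : is_derive x 1 (fun y => primitive u y - Q y) 0.
  by rewrite -(subrr (u x)); apply: is_deriveB.
have := is_derive_0_is_cst b a D0; rewrite /rint; lra.
Qed.

Lemma rintD u v a b : continuous u -> continuous v ->
  rint (fun x => u x + v x) a b = rint u a b + rint v a b.
Proof.
move=> cu cv; have dPu := primitiveP cu; have dPv := primitiveP cv.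
rewrite (@rint_unique _ (fun x => primitive u x + primitive v x)).
- by rewrite /rint; ring.
- by move=> x; apply: cvgD; [exact: cu|exact: cv].
Qed.

Lemma rintZ u k a b : continuous u -> rint (fun x => k * u x) a b = k * rint u a b.
Proof.
move=> cu; have dPu := primitiveP cu.
rewrite (@rint_unique _ (fun x => k * primitive u x)).
- by rewrite /rint; ring.
- by move=> x; apply: cvgM; [exact: cvg_cst|exact: cu].
Qed.

Lemma rint_le u M a b : continuous u -> a <= b ->
  (forall x, a <= x <= b -> `|u x| <= M) -> `|rint u a b| <= M * (b - a).
Proof.
move=> /primitiveP dP ab uM.
have [] := @MVT_segment R (primitive u) u a b ab.
- by apply: derivable_within_continuous => y _; have [] := dP y.
- move=> c; rewrite in_itv/= => cab; rewrite /rint => ->.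
  by rewrite normrM (ger0_norm (_ : 0 <= b - a)) ?subr_ge0// ler_wpM2r ?subr_ge0// uM.
Qed.

End Primitive.

Section ComplexIntegral.
Variable R : realType.
Local Notation C := (Cx R).
Implicit Types (f g : R -> C) (a b : R) (z w : C).

Lemma cx_eq z w : complex.Re z = complex.Re w -> complex.Im z = complex.Im w -> z = w.
Proof. by case: z; case: w => ? ? ? ? /= -> ->. Qed.
Lemma cxReD z w : complex.Re (z + w) = complex.Re z + complex.Re w.
Proof. by case: z; case: w. Qed.
Lemma cxImD z w : complex.Im (z + w) = complex.Im z + complex.Im w.
Proof. by case: z; case: w. Qed.
Lemma cxReN z : complex.Re (- z) = - complex.Re z.
Proof. by case: z. Qed.
Lemma cxImN z : complex.Im (- z) = - complex.Im z.
Proof. by case: z. Qed.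
Lemma cxReM z w : complex.Re (z * w) =
  complex.Re z * complex.Re w - complex.Im z * complex.Im w.
Proof. by case: z; case: w. Qed.
Lemma cxImM z w : complex.Im (z * w) =
  complex.Re z * complex.Im w + complex.Im z * complex.Re w.
Proof. by case: z; case: w. Qed.

Definition rcont f := forall x : R, ccont f x.

Lemma ccont_Re (T : topologicalType) (h : T -> C) (t : T) :
  ccont h t -> {for t, continuous (fun x => complex.Re (h x))}.
Proof.
move=> ch; apply/cvgrPdist_lt => e e0; apply: filterS (ch e e0) => y.
by apply: le_lt_trans; rewrite distrC -cxReN -cxReD cmod_Re.
Qed.

Lemma ccont_Im (T : topologicalType) (h : T -> C) (t : T) :
  ccont h t -> {for t, continuous (fun x => complex.Im (h x))}.
Proof.
move=> ch; apply/cvgrPdist_lt => e e0; apply: filterS (ch e e0) => y.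
by apply: le_lt_trans; rewrite distrC -cxImN -cxImD cmod_Im.
Qed.

Lemma ccont_RtoC (T : topologicalType) (h : T -> R) (t : T) :
  {for t, continuous h} -> ccont (fun x => RtoC (h x)) t.
Proof.
move=> /cvgrPdist_lt ch e /ch; apply: filterS => y.
by rewrite -RtoCB cmodRtoC distrC.
Qed.

Definition Cint f a b : C :=
  (rint (fun x => complex.Re (f x)) a b +i* rint (fun x => complex.Im (f x)) a b)%C.

Lemma Cint_chasles f c a b : Cint f a b = Cint f a c + Cint f c b.
Proof. by apply: cx_eq; rewrite ?cxReD ?cxImD /= /rint; ring. Qed.

Lemma CintD f g a b : rcont f -> rcont g ->
  Cint (fun x => f x + g x) a b = Cint f a b + Cint g a b.
Proof.
move=> cf cg.
have cRe (h : R -> C) : rcont h -> continuous (fun x => complex.Re (h x)).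
  by move=> ch x; exact: ccont_Re.
have cIm (h : R -> C) : rcont h -> continuous (fun x => complex.Im (h x)).
  by move=> ch x; exact: ccont_Im.
apply: cx_eq; rewrite ?cxReD ?cxImD /= -rintD; do ?[exact: cRe|exact: cIm];
  by congr rint; apply/funext => x; rewrite ?cxReD ?cxImD.
Qed.

Lemma CintZ c f a b : rcont f -> Cint (fun x => c * f x) a b = c * Cint f a b.
Proof.
move=> cf.
have cRe : continuous (fun x => complex.Re (f x)) by move=> x; exact: ccont_Re.
have cIm : continuous (fun x => complex.Im (f x)) by move=> x; exact: ccont_Im.
have cZ k (u : R -> R) : continuous u -> continuous (fun x => k * u x).
  by move=> cu x; apply: cvgM; [exact: cvg_cst|exact: cu].
apply: cx_eq; rewrite ?cxReM ?cxImM /= -?mulNr -!rintZ// -rintD; do ?[exact: cZ];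
  by congr rint; apply/funext => x; rewrite ?cxReM ?cxImM ?mulNr.
Qed.

Lemma Cint_le f a b (M : R) : rcont f -> a <= b ->
  (forall x, a <= x <= b -> cmod (f x) <= M) -> cmod (Cint f a b) <= 2 * M * (b - a).
Proof.
move=> cf ab fM.
have h1 : `|rint (fun x => complex.Re (f x)) a b| <= M * (b - a).
  apply: rint_le => //; first by move=> x; exact: ccont_Re.
  by move=> x /fM; apply: le_trans; exact: cmod_Re.
have h2 : `|rint (fun x => complex.Im (f x)) a b| <= M * (b - a).
  apply: rint_le => //; first by move=> x; exact: ccont_Im.
  by move=> x /fM; apply: le_trans; exact: cmod_Im.
by apply: le_trans (cmod_ReIm _) _ => /=; lra.
Qed.

Lemma Cint_RtoC (u Q : R -> R) a b : continuous u ->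
  (forall x : R, is_derive x 1 Q (u x)) ->
  Cint (fun x => RtoC (u x)) a b = RtoC (Q b - Q a).
Proof.
move=> cu dQ; apply: cx_eq => /=; first exact: rint_unique.
by rewrite (@rint_unique _ _ (fun=> 0)) ?subrr//; exact: cst_continuous.
Qed.

Lemma Cint_cst (c : C) a b : Cint (fun=> c) a b = c * RtoC (b - a).
Proof.
have -> : (fun _ : R => c) = (fun x => c * RtoC ((fun=> 1) x)).
  by apply/funext => x; rewrite RtoC1 mulr1.
rewrite CintZ; last by move=> x; exact: cvgC_cst.
by rewrite (@Cint_RtoC _ id)//; exact: cst_continuous.
Qed.

Lemma Cint_id a b : Cint (fun x => RtoC x) a b = RtoC ((b ^+ 2 - a ^+ 2) / 2).
Proof.
have dQ (x : R) : is_derive x 1 (fun x : R => 2^-1 * x ^+ 2) x.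
  have -> : (fun x : R => 2^-1 * x ^+ 2) = (2^-1 \*: ((id : R -> R) * id)).
    by apply/funext => y; rewrite expr2.
  have d := @is_deriveM R R id id x 1 1 1 (is_derive_id x 1) (is_derive_id x 1).
  by apply: (is_derive_eq (is_deriveZ 2^-1 d)); rewrite /GRing.scale /=; field.
have cid : continuous (fun x : R => x) by move=> x; exact: cvg_id.
by rewrite (Cint_RtoC _ _ cid dQ); congr RtoC; field.
Qed.

End ComplexIntegral.

(** * Goursat's theorem on rectangles *)

Section Goursat.
Variable R : realType.
Local Notation C := (Cx R).
Implicit Types (F G : R -> R -> C) (x y w h : R).

Definition ii : C := (0 +i* 1)%C.

Lemma cmod_ii : cmod ii = 1.
Proof. by rewrite cmodE /= expr0n expr1n add0r sqrtr1. Qed.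

(** Integrals are taken only along horizontal and vertical segments, so continuity in each variable
    separately is the right notion. *)
Definition sepcont F := (forall y, rcont (F^~ y)) /\ (forall x, rcont (F x)).

(** The contour integral of F (dx + i dy), counterclockwise: the bottom and right sides count
    positively, the top and left sides negatively. *)
Definition rectint F x1 x2 y1 y2 : C :=
  Cint (F^~ y1) x1 x2 + ii * Cint (F x2) y1 y2 - Cint (F^~ y2) x1 x2
  - ii * Cint (F x1) y1 y2.

Lemma rectint_split F xm ym x1 x2 y1 y2 : rectint F x1 x2 y1 y2 =
  rectint F x1 xm y1 ym + rectint F xm x2 y1 ym +
  (rectint F x1 xm ym y2 + rectint F xm x2 ym y2).
Proof.
rewrite /rectint (Cint_chasles (F^~ y1) xm) (Cint_chasles (F^~ y2) xm).
rewrite (Cint_chasles (F x1) ym) (Cint_chasles (F x2) ym).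
ring.
Qed.

Lemma rectintD F G x1 x2 y1 y2 : sepcont F -> sepcont G ->
  rectint (fun x y => F x y + G x y) x1 x2 y1 y2 =
  rectint F x1 x2 y1 y2 + rectint G x1 x2 y1 y2.
Proof.
by move=> [F1 F2] [G1 G2]; rewrite /rectint !CintD//; ring.
Qed.

Lemma rectint_le F x1 x2 y1 y2 (M : R) : sepcont F -> x1 <= x2 -> y1 <= y2 ->
  (forall x y, x1 <= x <= x2 -> y1 <= y <= y2 -> cmod (F x y) <= M) ->
  cmod (rectint F x1 x2 y1 y2) <= 4 * M * ((x2 - x1) + (y2 - y1)).
Proof.
move=> [F1 F2] x12 y12 FM.
have x1x : x1 <= x1 <= x2 by rewrite lexx. have x2x : x1 <= x2 <= x2 by rewrite lexx andbT.
have y1y : y1 <= y1 <= y2 by rewrite lexx. have y2y : y1 <= y2 <= y2 by rewrite lexx andbT.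
have h1 := Cint_le (F1 y1) x12 (fun x hx => FM x y1 hx y1y).
have h2 := Cint_le (F1 y2) x12 (fun x hx => FM x y2 hx y2y).
have h3 := Cint_le (F2 x1) y12 (fun y hy => FM x1 y x1x hy).
have h4 := Cint_le (F2 x2) y12 (fun y hy => FM x2 y x2x hy).
rewrite /rectint.
apply: le_trans (cmodD _ _) _; rewrite cmodN cmodM cmod_ii mul1r.
apply: le_trans (lerD (cmodD _ _) (lexx _)) _; rewrite cmodN.
apply: le_trans (lerD (lerD (cmodD _ _) (lexx _)) (lexx _)) _.
rewrite cmodM cmod_ii mul1r; lra.
Qed.

Definition affine (c d : C) (x0 y0 : R) x y : C :=
  c + d * (RtoC (x - x0) + ii * RtoC (y - y0)).

Lemma rcont_RtoC : rcont (@RtoC R).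
Proof. by move=> x; apply: ccont_RtoC; exact: cvg_id. Qed.

Lemma rcont_cst (c : C) : rcont (fun=> c).
Proof. by move=> x; exact: cvgC_cst. Qed.

Lemma rcont_affine (c d : C) : rcont (fun x => c + d * RtoC x).
Proof.
by move=> x; exact: cvgCD (rcont_cst c x) (cvgCM (rcont_cst d x) (rcont_RtoC x)).
Qed.

Lemma Cint_affine (c d : C) a b :
  Cint (fun x => c + d * RtoC x) a b =
  c * RtoC (b - a) + d * RtoC ((b ^+ 2 - a ^+ 2) / 2).
Proof.
rewrite CintD; last 2 first.
- exact: rcont_cst.
- by move=> x; exact: cvgCM (rcont_cst d x) (rcont_RtoC x).
by rewrite CintZ ?Cint_cst ?Cint_id//; exact: rcont_RtoC.
Qed.

Lemma affine_hor c d x0 y0 y : (affine c d x0 y0)^~ y =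
  fun x => (c + d * (ii * RtoC (y - y0) - RtoC x0)) + d * RtoC x.
Proof. by apply/funext => x; rewrite /affine RtoCB; ring. Qed.

Lemma affine_ver c d x0 y0 x : affine c d x0 y0 x =
  fun y => (c + d * (RtoC (x - x0) - ii * RtoC y0)) + (d * ii) * RtoC y.
Proof. by apply/funext => y; rewrite /affine RtoCB; ring. Qed.

Lemma sepcont_affine c d x0 y0 : sepcont (affine c d x0 y0).
Proof.
by split=> t; rewrite (affine_hor, affine_ver); exact: rcont_affine.
Qed.

Lemma rectint_affine c d x0 y0 x1 x2 y1 y2 :
  rectint (affine c d x0 y0) x1 x2 y1 y2 = 0.
Proof.
rewrite /rectint !affine_hor !affine_ver !Cint_affine.
by apply: cx_eq; rewrite !(cxReD, cxImD, cxReN, cxImN, cxReM, cxImM) /RtoC /ii /=; field.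
Qed.

(** Complex differentiability at x0 + i y0 in real coordinates: the differential is multiplication
    by [d], which encodes the Cauchy-Riemann equations. Distances are measured in the l1 norm. *)
Definition rdiff F x0 y0 := exists d : C, forall e : R, 0 < e ->
  exists2 r : R, 0 < r & forall x y, `|x - x0| + `|y - y0| < r ->
    cmod (F x y - affine (F x0 y0) d x0 y0 x y) <= e * (`|x - x0| + `|y - y0|).

End Goursat.

Section GoursatTheorem.
Variable R : realType.
Local Notation C := (Cx R).
Implicit Types (F : R -> R -> C) (x y w h : R).

Lemma nested_intervals (a l : nat -> R) :
  (forall n, 0 <= l n) -> (forall n, a n <= a n.+1) ->
  (forall n, a n.+1 + l n.+1 <= a n + l n) ->
  exists x, forall n, a n <= x <= a n + l n.
Proof.
move=> l0 a1 al.
have amono m n : (m <= n)%N -> a m <= a n.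
  by move=> /subnK <-; elim: (n - m)%N => //= k ih; exact: le_trans ih (a1 _).
have lmono m n : (m <= n)%N -> a n + l n <= a m + l m.
  by move=> /subnK <-; elim: (n - m)%N => //= k ih; exact: le_trans (al _) ih.
have ub n : ubound (range a) (a n + l n).
  move=> _ [m _ <-]; have [mn|/ltnW nm] := leqP m n.
    by apply: le_trans (amono _ _ mn) _; rewrite lerDl.
  by apply: le_trans (lmono _ _ nm); rewrite lerDl.
have hs : has_sup (range a).
  by split; [exists (a 0%N); exists 0%N|exists (a 0%N + l 0%N); exact: ub].
exists (sup (range a)) => n; apply/andP; split.
  by apply: sup_upper_bound => //; exists n.
by apply: ge_sup => //; case: hs.
Qed.

(** Quartering: some quarter of a rectangle carries at least a quarter of the modulus of its
    integral. At the point common to the nested rectangles [F] is affine up to a small multiple of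
    the distance, and affine functions integrate to 0. The integral is then bounded by a small
    multiple of the squared size, which decays at the same rate as the lower bound but with a
    smaller constant. *)
Lemma goursat F x1 y1 w h : sepcont F -> 0 < w -> 0 < h ->
  (forall x y, x1 <= x <= x1 + w -> y1 <= y <= y1 + h -> rdiff F x y) ->
  rectint F x1 (x1 + w) y1 (y1 + h) = 0.
Proof.
move=> cF w0 h0 dF; apply: contrapT => /eqP; rewrite -cmod_gt0.
set c0 := cmod _ => c0gt.
have two_gt0 n : 0 < (2 : R) ^+ n by rewrite exprn_gt0.
pose W n := w / 2 ^+ n; pose H n := h / 2 ^+ n.
have WS n : W n = W n.+1 + W n.+1 by rewrite /W exprS; field; rewrite expf_neq0.
have HS n : H n = H n.+1 + H n.+1 by rewrite /H exprS; field; rewrite expf_neq0.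
have Wp n : 0 < W n by rewrite divr_gt0.
have Hp n : 0 < H n by rewrite divr_gt0.
pose Q n := c0 / 2 ^+ n / 2 ^+ n.
have QS n : Q n = 4 * Q n.+1 by rewrite /Q exprS; field; rewrite expf_neq0.
pose P n (p : R * R) := Q n <= cmod (rectint F p.1 (p.1 + W n) p.2 (p.2 + H n)).
(* The inclusions hold unconditionally and only the lower bound is an implication, so that [choice]
   can be applied to arbitrary corners. *)
have step (np : nat * (R * R)) : exists p' : R * R,
    [/\ np.2.1 <= p'.1, p'.1 + W np.1.+1 <= np.2.1 + W np.1,
        np.2.2 <= p'.2, p'.2 + H np.1.+1 <= np.2.2 + H np.1 &
        P np.1 np.2 -> P np.1.+1 p'].
  case: np => n [x y] /=; rewrite /P /=.
  have Wn := Wp n.+1; have Hn := Hp n.+1; rewrite (WS n) (HS n) (QS n).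
  rewrite [x + (_ + _)]addrA [y + (_ + _)]addrA.
  rewrite (rectint_split F (x + W n.+1) (y + H n.+1)).
  set w' := W n.+1 in Wn *; set h' := H n.+1 in Hn *; set q := Q n.+1.
  set A := rectint F x (x + w') y (y + h').
  set B := rectint F (x + w') (x + w' + w') y (y + h').
  set D := rectint F x (x + w') (y + h') (y + h' + h').
  set E := rectint F (x + w') (x + w' + w') (y + h') (y + h' + h').
  have [qA|qA] := leP q (cmod A); first by exists (x, y); split => //=; lra.
  have [qB|qB] := leP q (cmod B); first by exists (x + w', y); split => //=; lra.
  have [qD|qD] := leP q (cmod D); first by exists (x, y + h'); split => //=; lra.
  have [qE|qE] := leP q (cmod E); first by exists (x + w', y + h'); split => //=; lra.
  exists (x, y); split => /=; [lra|lra|lra|lra|] => bad; exfalso.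
  have : cmod (A + B + (D + E)) <= cmod A + cmod B + (cmod D + cmod E).
    by apply: le_trans (cmodD _ _) _; apply: lerD; exact: cmodD.
  by move: bad; lra.
have [g gP] := choice step.
pose p := nat_rect (fun=> R * R)%type (x1, y1) (fun n q => g (n, q)).
have pS n : p n.+1 = g (n, p n) by [].
have pP n : P n (p n).
  elim: n => [|n ih]; first by rewrite /P /Q /W /H /= !expr0 !divr1.
  by rewrite pS; case: (gP (n, p n)) => _ _ _ _; exact.
have [x xP] : exists x, forall n, (p n).1 <= x <= (p n).1 + W n.
  apply: (@nested_intervals (fun n => (p n).1) W) => n; first exact: ltW.
  - by rewrite pS; case: (gP (n, p n)).
  - by rewrite pS; case: (gP (n, p n)).
have [y yP] : exists y, forall n, (p n).2 <= y <= (p n).2 + H n.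
  apply: (@nested_intervals (fun n => (p n).2) H) => n; first exact: ltW.
  - by rewrite pS; case: (gP (n, p n)).
  - by rewrite pS; case: (gP (n, p n)).
have [d dP] : rdiff F x y.
  by have := xP 0%N; have := yP 0%N; rewrite /W /H !expr0 !divr1 => ? ?; exact: dF.
have wh0 : 0 < w + h by rewrite addr_gt0.
(* With this precision the upper bound [4 * e * (W n + H n) ^+ 2] is exactly half of the lower bound
   [Q n]. *)
have [r r0 rP] := dP (c0 / (8 * (w + h) ^+ 2)) ltac:(by rewrite divr_gt0// mulr_gt0// exprn_gt0).
have [n nr] : exists n, (w + h) / 2 ^+ n < r.
  have [n hn] : exists n : nat, (w + h) / r < n%:R.
    by exists (Num.truncn ((w + h) / r)).+1; rewrite truncnS_gt.
  exists n; rewrite ltr_pdivrMr// mulrC -ltr_pdivrMr//; apply: lt_trans hn _.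
  by rewrite -natrX ltr_nat ltn_expl.
have Wr : W n + H n = (w + h) / 2 ^+ n by rewrite /W /H -mulrDl.
set e := c0 / _ in rP.
have e0 : 0 < e by rewrite divr_gt0// mulr_gt0// exprn_gt0.
pose A := affine (F x y) d x y.
have cA : sepcont A by exact: sepcont_affine.
have cFA : sepcont (fun x y => F x y - A x y).
  case: cF cA => [F1 F2] [A1 A2]; split=> t u.
    exact: cvgCB (F1 t u) (A1 t u).
  exact: cvgCB (F2 t u) (A2 t u).
have FA : F = (fun x y => (F x y - A x y) + A x y).
  by apply/funext => s; apply/funext => t; rewrite subrK.
have := pP n; rewrite /P FA rectintD// rectint_affine addr0.
have bound : cmod (rectint (fun x y => F x y - A x y) (p n).1 ((p n).1 + W n)
    (p n).2 ((p n).2 + H n)) <= 4 * (e * (W n + H n)) * (W n + H n).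
  have -> : W n + H n = ((p n).1 + W n - (p n).1) + ((p n).2 + H n - (p n).2) by ring.
  apply: rectint_le => //; [by rewrite lerDl ltW|by rewrite lerDl ltW|].
  move=> s t sP tP.
  have st : `|s - x| + `|t - y| <= W n + H n.
    have := xP n; have := yP n => yPn xPn.
    by apply: lerD; rewrite ler_norml; apply/andP; split; lra.
  apply: le_trans (rP s t _) _; first by apply: le_lt_trans st _; rewrite Wr.
  apply: ler_wpM2l; first exact: ltW.
  by apply: le_trans st _; lra.
move=> /le_trans /(_ bound); rewrite Wr /Q /e.
have -> : 4 * (c0 / (8 * (w + h) ^+ 2) * ((w + h) / 2 ^+ n)) * ((w + h) / 2 ^+ n)
   = (c0 / 2 ^+ n / 2 ^+ n) / 2.
  by field; rewrite expf_neq0//= gt_eqF.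
have : 0 < c0 / 2 ^+ n / 2 ^+ n by rewrite !divr_gt0.
lra.
Qed.

End GoursatTheorem.

(** * Means over circles *)

Section CircleMean.
Variable R : realType.
Local Notation C := (Cx R).
Local Notation tau := (pi *+ 2 : R).
Implicit Types (g : C -> C) (a z : C) (s t u v : R).

Lemma is_derive_le (f : R -> R) (x d e : R) : is_derive x 1 f d -> 0 < e ->
  exists2 r : R, 0 < r & forall u, `|u| < r -> `|f (x + u) - f x - d * u| <= e * `|u|.
Proof.
move=> [dv dE] e0.
have /cvgrPdist_lt/(_ e e0) : h^-1 *: (f (h *: 1 + x) - f x) @[h --> 0^'] --> d.
  by rewrite -dE; exact: dv.
rewrite /dnbhs => /nbhs_ballP[r /= r0 h]; exists r => // u ur.
have [->|u0] := eqVneq u 0; first by rewrite addr0 subrr mulr0 subrr normr0 mulr0.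
have := h u; rewrite -ball_normE /ball_/= sub0r normrN => /(_ ur u0) /ltW.
rewrite /GRing.scale/= mulr1 distrC [u + x]addrC => hh.
rewrite (_ : _ - _ - _ = (u^-1 * (f (x + u) - f x) - d) * u); last by field.
by rewrite normrM ler_wpM2r.
Qed.

Lemma expi_add u v : expi (u + v) = expi u * expi v :> C.
Proof. by apply: cx_eq; rewrite (cxReM, cxImM) /= (cosD, sinD)//; ring. Qed.

Lemma expi0 : expi 0 = 1 :> C.
Proof. by apply: cx_eq; rewrite /= (cos0, sin0). Qed.

Lemma expi_tau : expi tau = 1 :> C.
Proof. by apply: cx_eq; rewrite /= (cos2pi, sin2pi). Qed.

Lemma cmod_expi u : cmod (expi u : C) = 1.
Proof. by rewrite cmodE /= cos2Dsin2 sqrtr1. Qed.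

Lemma ccont_expi : rcont (@expi R).
Proof.
move=> x.
have c1 : ccont (fun y => RtoC (cos y)) x by apply: ccont_RtoC; exact: continuous_cos.
have c2 : ccont (fun y => RtoC (sin y)) x by apply: ccont_RtoC; exact: continuous_sin.
have -> : @expi R = fun y => RtoC (cos y) + ii R * RtoC (sin y).
  apply/funext => y.
  by apply: cx_eq; rewrite !(cxReD, cxImD, cxReM, cxImM) /=; ring.
exact: cvgCD c1 (cvgCM (cvgC_cst x (ii R)) c2).
Qed.

Definition cexp u v : C := RtoC (expR u) * expi v.

Lemma cexp_add s t u v : cexp (s + u) (t + v) = cexp s t * cexp u v.
Proof. by rewrite /cexp expRD RtoCM expi_add; ring. Qed.

Lemma cexp_near0 (e : R) : 0 < e -> exists2 r : R, 0 < r & forall u v,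
  `|u| + `|v| < r ->
  cmod (cexp u v - 1 - (RtoC u + ii R * RtoC v)) <= e * (`|u| + `|v|).
Proof.
(* The errors of the real and imaginary parts below add up to e'|u| + 8 e'|v|. The cap at 1 gives
   |exp u - 1| <= 2|u|, and [e'] also serves as a radius to make this at most 2 e'. *)
move=> e0; pose e' := Num.min 1 (e / 8).
have e'0 : 0 < e' by rewrite lt_min ltr01 divr_gt0.
have e'1 : e' <= 1 by rewrite ge_min lexx.
have e'8 : 8 * e' <= e.
  have : e' <= e / 8 by rewrite ge_min lexx orbT.
  lra.
have [r1 r10 h1] := is_derive_le (is_derive_expR 0) e'0.
have [r2 r20 h2] := is_derive_le (is_derive_cos 0) e'0.
have [r3 r30 h3] := is_derive_le (is_derive_sin 0) e'0.
exists (Num.min (Num.min r1 r2) (Num.min r3 e')).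
  by rewrite 3!lt_min r10 r20 r30 e'0.
move=> u v; rewrite 3!lt_min => /andP[/andP[uv1 uv2] /andP[uv3 uve]].
have u0 := normr_ge0 u; have v0 := normr_ge0 v.
have := h1 u ltac:(lra); rewrite expR0 add0r mul1r => a.
have := h2 v ltac:(lra); rewrite cos0 sin0 add0r oppr0 mul0r subr0 => b.
have := h3 v ltac:(lra); rewrite cos0 sin0 add0r mul1r subr0 => c.
have E3 : `|expR u - 1| <= 2 * `|u|.
  rewrite (_ : expR u - 1 = (expR u - 1 - u) + u); last by ring.
  apply: le_trans (ler_normD _ _) _.
  have : e' * `|u| <= 1 * `|u| by rewrite ler_wpM2r.
  lra.
have E3' : `|expR u| <= 3.
  rewrite (_ : expR u = (expR u - 1) + 1); last by ring.
  apply: le_trans (ler_normD _ _) _; rewrite normr1; lra.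
apply: le_trans (cmod_ReIm _) _.
rewrite !(cxReD, cxImD, cxReN, cxImN, cxReM, cxImM) /RtoC /ii /=.
have p1 : `|expR u * cos v - 0 * sin v + - 1 + - (u + (0 * v - 1 * 0))| <=
    e' * `|u| + 3 * (e' * `|v|).
  rewrite [X in `|X| <= _](_ : _ = (expR u - 1 - u) + expR u * (cos v - 1)); last by ring.
  apply: le_trans (ler_normD _ _) _; apply: lerD => //.
  by rewrite normrM; apply: ler_pM.
have p2 : `|expR u * sin v + 0 * cos v + - 0 + - (0 + (0 * 0 + 1 * v))| <=
    2 * e' * `|v| + 3 * (e' * `|v|).
  rewrite [X in `|X| <= _](_ : _ = (expR u - 1) * v + expR u * (sin v - v)); last by ring.
  apply: le_trans (ler_normD _ _) _; apply: lerD; rewrite normrM.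
    by rewrite ler_wpM2r//; lra.
  exact: ler_pM.
apply: le_trans (lerD p1 p2) _.
have q1 : 8 * e' * `|u| <= e * `|u| by rewrite ler_wpM2r.
have q2 : 8 * e' * `|v| <= e * `|v| by rewrite ler_wpM2r.
have q3 : 0 <= e' * `|u| by rewrite mulr_ge0// ltW.
lra.
Qed.

Lemma cmod_cexp u v : cmod (cexp u v) = expR u.
Proof. by rewrite cmodM cmod_expi mulr1 cmodRtoC ger0_norm// expR_ge0. Qed.

(** The chain rule with derivative d e^(s + it). By the functional equation, the behaviour of the
    exponential at s + it is that at 0 multiplied by [E0]. *)
Lemma rdiff_cexp g a s t d : cdiff g (a + cexp s t) d ->
  rdiff (fun s t => g (a + cexp s t)) s t.
Proof.
set E0 := cexp s t => -[q [gq qd cq]]; exists (d * E0) => e e0.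
have K0 : 0 < cmod E0 by rewrite cmod_cexp expR_gt0.
have D0 := cmod_ge0 d.
set K := cmod E0 in K0 *.
have [r1 r10 h1] := (ccont_cmod q (a + E0)).1 cq (e / (4 * K))
  ltac:(by rewrite divr_gt0// mulr_gt0).
(* The variation of the slope [q] and the error of the exponential contribute [e / 2] each;
   [cmod d + 1] replaces [cmod d], which may be 0, in the denominator. *)
have K1 : 0 < 2 * K * (cmod d + 1) by rewrite mulr_gt0 ?mulr_gt0//; lra.
have m0 : 0 < Num.min 1 (e / (2 * K * (cmod d + 1))) by rewrite lt_min ltr01 divr_gt0.
have [r2 r20 h2] := cexp_near0 m0.
have m1 : Num.min 1 (e / (2 * K * (cmod d + 1))) <= 1 by rewrite ge_min lexx.
have m2 : Num.min 1 (e / (2 * K * (cmod d + 1))) <= e / (2 * K * (cmod d + 1)) by rewrite ge_min lexx orbT.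
set m := Num.min _ _ in m0 h2 m1 m2.
exists (Num.min (r1 / (3 * K)) r2); first by rewrite lt_min r20 divr_gt0// mulr_gt0.
move=> x y; rewrite lt_min => /andP[xy1 xy2].
have := h2 _ _ xy2; set N := `|x - s| + `|y - t| in xy1 xy2 *.
have N0 : 0 <= N by rewrite addr_ge0.
set w := cexp (x - s) (y - t) - 1; set D := RtoC (x - s) + _ => wD.
have ED : cexp x y = E0 + E0 * w.
  rewrite /w mulrBr mulr1 subrKC /E0 -cexp_add; congr cexp; ring.
have Dle : cmod D <= N.
  apply: le_trans (cmodD _ _) _.
  by rewrite cmodM cmod_ii mul1r !cmodRtoC.
have wle : cmod w <= 2 * N.
  rewrite (_ : w = (w - D) + D); last by ring.
  apply: le_trans (cmodD _ _) _.
  have : m * N <= 1 * N by rewrite ler_wpM2r.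
  lra.
have argE : a + cexp x y = (a + E0) + E0 * w by rewrite ED addrA.
have qle : cmod (q (a + cexp x y) - d) <= e / (4 * K).
  rewrite -qd; apply/ltW/h1; rewrite argE addrC addKr cmodM -/K.
  move: xy1; rewrite ltr_pdivlMr ?mulr_gt0// => xy1.
  have : K * cmod w <= K * (2 * N) by rewrite ler_wpM2l// ltW.
  have : 0 <= K * N by rewrite mulr_ge0// ltW.
  lra.
rewrite /affine -/D.
rewrite (_ : _ - _ = (q (a + cexp x y) - d) * (E0 * w) + d * E0 * (w - D)); last first.
  by rewrite gq argE; ring.
apply: le_trans (cmodD _ _) _.
rewrite (cmodM _ (E0 * w)) (cmodM E0 w) (cmodM (d * E0)) (cmodM d E0) -/K.
have p1 : cmod (q (a + cexp x y) - d) * (K * cmod w) <= (e / (4 * K)) * (K * (2 * N)).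
  apply: ler_pM; [exact: cmod_ge0| |exact: qle|by rewrite ler_pM2l].
  by rewrite mulr_ge0 ?cmod_ge0// ltW.
have p2 : cmod d * K * cmod (w - D) <= (cmod d + 1) * K * (e / (2 * K * (cmod d + 1)) * N).
  apply: ler_pM; [by rewrite mulr_ge0// ltW|exact: cmod_ge0| |].
    by apply: ler_wpM2r; [exact: ltW|rewrite lerDl].
  by apply: le_trans wD _; rewrite ler_wpM2r.
apply: le_trans (lerD p1 p2) _.
have dn0 : cmod d + 1 != 0 by rewrite gt_eqF//; lra.
rewrite (_ : _ + _ = e * N)//; field.
by rewrite dn0 ?andbT gt_eqF.
Qed.

(** In the coordinates a + e^(s + it) the annulus becomes the rectangle [ln r1, ln r2] x [0, 2 pi].
    Periodicity in t cancels the two horizontal sides in Goursat's theorem, and the vertical ones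
    give i times the difference of the two integrals. *)
Lemma circle_mean_cst g a (r r1 r2 : R) :
  (forall z, 0 < cmod (z - a) < r -> exists d, cdiff g z d) ->
  0 < r1 -> r1 < r2 -> r2 < r ->
  Cint (fun t => g (a + RtoC r1 * expi t)) 0 tau =
  Cint (fun t => g (a + RtoC r2 * expi t)) 0 tau.
Proof.
move=> dg r10 r12 r2r.
have r20 : 0 < r2 := lt_trans r10 r12.
pose m := (r2 + r) / 2; have m0 : 0 < m by rewrite /m; lra.
have mr : m < r by rewrite /m; lra.
have r2m : r2 < m by rewrite /m; lra.
(* Truncating s at a level beyond [ln r2] keeps every argument of [g] in the punctured disc, which
   makes [F] continuous in each variable on the whole line without changing it near the
   rectangle. *)
pose sg := ln m; pose F s t := g (a + cexp (Num.min s sg) t).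
have pt s t : 0 < cmod (a + cexp (Num.min s sg) t - a) < r.
  rewrite addrC addKr cmod_cexp expR_gt0 /=; apply: le_lt_trans mr.
  by rewrite -[m]lnK// ler_expR ge_min lexx orbT.
have cg s t : ccont g (a + cexp (Num.min s sg) t).
  by have [d] := dg _ (pt s t); exact: cdiff_continuous.
have cF : sepcont F.
  split=> [t s|s t].
    apply: (@cvgC_comp _ _ (fun s => a + cexp (Num.min s sg) t)); last exact: cg.
    apply: (cvgCD (cvgC_cst s a)); apply: (fun h => cvgCM h (cvgC_cst s (expi t))).
    apply: ccont_RtoC.
    apply: (@continuous_comp _ _ _ (fun s => Num.min s sg) expR); last exact: continuous_expR.
    by apply: continuous_min; [exact: cvg_id|exact: cvg_cst].
  apply: (@cvgC_comp _ _ (fun t => a + cexp (Num.min s sg) t)); last exact: cg.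
  exact: cvgCD (cvgC_cst t a) (cvgCM (cvgC_cst t _) (ccont_expi t)).
have s12 : 0 < ln r2 - ln r1 by rewrite subr_gt0 ltr_ln.
have tau0 : 0 < tau by rewrite mulrn_wgt0// pi_gt0.
have dF x y : ln r1 <= x <= ln r1 + (ln r2 - ln r1) -> 0 <= y <= 0 + tau -> rdiff F x y.
  rewrite subrKC => /andP[_ x2] _.
  have xs : x < sg by apply: le_lt_trans x2 _; rewrite ltr_ln.
  have mx : Num.min x sg = x by apply/min_idPl/ltW.
  have [d dd] := dg _ (pt x y); rewrite mx in dd.
  have [k kP] := rdiff_cexp dd; exists k => e /kP[r' r'0 h].
  exists (Num.min r' (sg - x)); first by rewrite lt_min r'0 subr_gt0.
  move=> s t; rewrite lt_min => /andP[st1 st2].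
  have ss : s < sg.
    have := ler_norm (s - x); have := normr_ge0 (t - y); lra.
  have -> : F s t = g (a + cexp s t) by rewrite /F (min_idPl (ltW ss)).
  have -> : F x y = g (a + cexp x y) by rewrite /F mx.
  exact: h.
have := goursat cF s12 tau0 dF.
rewrite subrKC add0r /rectint.
have -> : F^~ tau = F^~ 0 by apply/funext => s; rewrite /F /cexp expi_tau expi0.
have Fr (r' : R) : 0 < r' -> r' < m -> F (ln r') = fun t => g (a + RtoC r' * expi t).
  move=> r'0 r'm; apply/funext => t.
  have rs : ln r' <= sg by apply/ltW; rewrite ltr_ln.
  by rewrite /F (min_idPl rs) /cexp lnK.
rewrite Fr// Fr//; last exact: lt_trans r2m.
set A := Cint _ _ _; set B := Cint _ _ _; set D := Cint _ _ _.
rewrite (_ : _ - _ - _ = ii R * (B - D)); last by ring.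
move/eqP; rewrite mulf_eq0 => /orP[/eqP i0|/eqP /subr0_eq//].
by have := cmod_ii R; rewrite i0 cmod0 => /esym/eqP; rewrite oner_eq0.
Qed.

(** The radius may be shrunk without changing the integral, and on small circles [g] is close to
    [l]. The value of [g] at [a] never enters, so difference quotients can be used with their
    default value there. *)
Lemma circle_mean g a l (r p : R) :
  (forall z, 0 < cmod (z - a) < r -> exists d, cdiff g z d) ->
  (forall e : R, 0 < e -> exists2 r' : R, 0 < r' &
    forall z, 0 < cmod (z - a) < r' -> cmod (g z - l) < e) ->
  0 < p < r ->
  Cint (fun t => g (a + RtoC p * expi t)) 0 tau = l * RtoC tau.
Proof.
move=> dg lg /andP[p0 pr]; apply/subr0_eq/cmod_eq0.
have tau0 : 0 < tau by rewrite mulrn_wgt0// pi_gt0.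
have pt (r' t : R) : 0 < r' -> cmod (a + RtoC r' * expi t - a) = r'.
  by move=> r'0; rewrite addrC addKr cmodM cmod_expi mulr1 cmodRtoC gtr0_norm.
have rc (r' : R) : 0 < r' -> r' < r -> rcont (fun t => g (a + RtoC r' * expi t)).
  move=> r'0 r'r t; apply: (@cvgC_comp _ _ (fun t => a + RtoC r' * expi t)).
    exact: cvgCD (cvgC_cst t a) (cvgCM (cvgC_cst t _) (ccont_expi t)).
  have [|d] := dg (a + RtoC r' * expi t); first by rewrite pt// r'0.
  exact: cdiff_continuous.
have bound (e : R) : 0 < e ->
    cmod (Cint (fun t => g (a + RtoC p * expi t)) 0 tau - l * RtoC tau) <=
    2 * e * (tau - 0).
  move=> e0; have [r' r'0 h] := lg e e0.
  pose q := Num.min (r' / 2) (p / 2).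
  have q0 : 0 < q by rewrite lt_min !divr_gt0.
  have qp : q < p.
    have : q <= p / 2 by rewrite ge_min lexx orbT.
    lra.
  have qr' : q < r'.
    have : q <= r' / 2 by rewrite ge_min lexx.
    lra.
  rewrite -(circle_mean_cst dg q0 qp pr) -[tau in l * RtoC tau]subr0 -Cint_cst.
  rewrite -mulN1r -CintZ; last by move=> t; exact: cvgC_cst.
  rewrite -CintD; last 2 first.
  - exact: rc (lt_trans qp pr).
  - by move=> t; exact: cvgC_cst.
  apply: Cint_le; [|exact: ltW|].
    move=> t; exact: cvgCD (rc q q0 (lt_trans qp pr) t) (cvgC_cst t _).
  by move=> t _; rewrite mulN1r; apply/ltW/h; rewrite pt// q0.
apply/eqP; rewrite eq_le cmod_ge0 andbT; apply/ler_addgt0Pl => e e0.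
rewrite addr0; have := bound (e / (2 * tau)) ltac:(by rewrite divr_gt0// mulr_gt0).
rewrite subr0 (_ : 2 * (e / (2 * tau)) * tau = e)//.
by move: (lt0r_neq0 tau0); move: (tau) => T T0; field.
Qed.

End CircleMean.

(** * Inverses of injective holomorphic functions *)

Section InverseHolomorphic.
Variable R : realType.
Local Notation C := (Cx R).
Local Notation tau := (pi *+ 2 : R).
Implicit Types (h k : C -> C) (a z d : C).

Lemma tau_gt0 : 0 < tau.
Proof. by rewrite mulrn_wgt0// pi_gt0. Qed.

Lemma is_derive0_le (f : R -> R) (x : R) :
  (forall e : R, 0 < e -> exists2 r : R, 0 < r &
     forall u, `|u| < r -> `|f (x + u) - f x| <= e * `|u|) -> is_derive x 1 f 0.
Proof.
move=> hf.
have cv : h^-1 *: (f (h *: 1 + x) - f x) @[h --> 0^'] --> (0 : R).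
  apply/cvgrPdist_le => e /hf[r r0 h]; rewrite /dnbhs.
  apply/nbhs_ballP; exists r => //= u; rewrite -ball_normE /ball_/= sub0r normrN => ur u0.
  rewrite /GRing.scale/= mulr1 sub0r normrN normrM normfV [u + x]addrC.
  by rewrite mulrC ler_pdivrMr ?normr_gt0// h.
by apply: DeriveDef; [apply/cvg_ex; exists 0|apply/cvg_lim].
Qed.

Lemma deriv0_cst h z0 (r : R) : (forall z, cmod (z - z0) < r -> cdiff h z 0) ->
  forall z, cmod (z - z0) < r -> h z = h z0.
Proof.
move=> dh z zr; pose v := z - z0; pose p (t : R) := h (z0 + RtoC t * v).
have v0 := cmod_ge0 v.
have dp (t : R) : 0 <= t <= 1 -> forall e : R, 0 < e -> exists2 r' : R, 0 < r' &
    forall u, `|u| < r' -> cmod (p (t + u) - p t) <= e * `|u|.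
  move=> /andP[t0 t1] e e0.
  have tz : cmod (z0 + RtoC t * v - z0) < r.
    rewrite addrC addKr cmodM cmodRtoC ger0_norm//; apply: le_lt_trans zr.
    by rewrite -[leRHS]mul1r ler_wpM2r.
  have V0 : 0 < cmod v + 1 by lra.
  have [r' r'0 hr] := cdiff_le (dh _ tz) (divr_gt0 e0 V0).
  exists (r' / (cmod v + 1)); first by rewrite divr_gt0.
  move=> u; rewrite ltr_pdivlMr// => ur; have u0 := normr_ge0 u.
  have := hr (z0 + RtoC (t + u) * v).
  rewrite (_ : z0 + RtoC (t + u) * v - (z0 + RtoC t * v) = RtoC u * v); last first.
    by rewrite RtoCD; ring.
  rewrite mul0r subr0 -/(p t) -/(p (t + u)) cmodM cmodRtoC => hp.
  have uv : `|u| * cmod v <= `|u| * (cmod v + 1) by rewrite ler_wpM2l//; lra.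
  apply: le_trans (hp (le_lt_trans uv ur)) _.
  apply: le_trans (ler_wpM2l _ uv) _; first by rewrite ltW// divr_gt0.
  rewrite (_ : _ * _ = e * `|u|)//; field.
  by rewrite gt_eqF.
have cst (P : C -> R) : (forall w, `|P w| <= cmod w) ->
    (forall w w', P (w - w') = P w - P w') -> P (p 1) - P (p 0) = 0.
  move=> Ple PB.
  have dP (t : R) : 0 <= t <= 1 -> is_derive t 1 (fun t => P (p t)) 0.
    move=> t01; apply: is_derive0_le => e /(dp t t01)[r' r'0 hr]; exists r' => // u ur.
    by rewrite -PB; apply: le_trans (Ple _) (hr u ur).
  have [] := @MVT_segment R (fun t => P (p t)) (fun=> 0) 0 1 ler01.
  - by move=> t; rewrite in_itv/= => /andP[? ?]; apply: dP; apply/andP; split; lra.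
  - by apply: derivable_within_continuous => t; rewrite in_itv/= => /dP[].
  - by move=> c _ ->; rewrite mul0r.
have p1 : p 1 = h z by rewrite /p RtoC1 mul1r subrKC.
have p0 : p 0 = h z0 by rewrite /p RtoC0 mul0r addr0.
rewrite -p1 -p0; apply: cx_eq; apply/subr0_eq.
- by apply: cst => [w|w w']; [exact: cmod_Re|rewrite cxReD cxReN].
- by apply: cst => [w|w w']; [exact: cmod_Im|rewrite cxImD cxImN].
Qed.

Lemma circle_tube h z0 (p e : R) : 0 < e ->
  (forall t, ccont h (z0 + RtoC p * expi t)) ->
  exists2 r : R, 0 < r & forall a, cmod (a - z0) < r -> forall t, 0 <= t <= tau ->
    cmod (h (a + RtoC p * expi t) - h (z0 + RtoC p * expi t)) < e.
Proof.
move=> e0 ch.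
have /compact_near_coveringP cK : compact `[0, tau]%classic := @segment_compact R 0 tau.
have /nbhs_cmod[r r0 hr] : nbhs z0 (fun a => `[0, tau]%classic `<=`
    (fun t => cmod (h (a + RtoC p * expi t) - h (z0 + RtoC p * expi t)) < e)).
  apply: (cK C (nbhs z0) (fun a t => cmod (h (a + RtoC p * expi t) -
    h (z0 + RtoC p * expi t)) < e) (nbhs_filter z0)) => t _.
  have [d d0 hd] := (ccont_cmod h _).1 (ch t) (e / 2) ltac:(by rewrite divr_gt0).
  have ct : ccont (fun t => z0 + RtoC p * expi t) t.
    exact: cvgCD (cvgC_cst t z0) (cvgCM (cvgC_cst t _) (@ccont_expi R t)).
  have nt := ct (d / 2) ltac:(by rewrite divr_gt0).
  exists ([set t' | cmod (z0 + RtoC p * expi t' - (z0 + RtoC p * expi t)) < d / 2],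
     [set a | cmod (a - z0) < d / 2]).
    split => //=; apply/nbhs_cmod; exists (d / 2) => //; by rewrite divr_gt0.
  move=> [t' a] /= [h1 h2].
  have k1 : cmod (h (z0 + RtoC p * expi t') - h (z0 + RtoC p * expi t)) < e / 2.
    by apply: hd; lra.
  have k2 : cmod (h (a + RtoC p * expi t') - h (z0 + RtoC p * expi t)) < e / 2.
    apply: hd.
    rewrite (_ : _ - _ = (a - z0) + (z0 + RtoC p * expi t' - (z0 + RtoC p * expi t))); last by ring.
    by apply: le_lt_trans (cmodD _ _) _; lra.
  apply: le_lt_trans (cmodD3 _ (h (z0 + RtoC p * expi t)) _) _.
  by rewrite [cmod (_ - h (z0 + _ * expi t'))]cmodB; lra.
exists r => // a ar t tt; exact: (hr a ar).
Qed.

Lemma deriv_circle_mean h a d (r p : R) : 0 < p < r ->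
  (forall z, cmod (z - a) < r -> exists d', cdiff h z d') -> cdiff h a d ->
  Cint (fun t => (h (a + RtoC p * expi t) - h a) / (RtoC p * expi t)) 0 tau =
  d * RtoC tau.
Proof.
move=> pr dh da.
pose g z := (h z - h a) / (z - a).
have gE : (fun t => (h (a + RtoC p * expi t) - h a) / (RtoC p * expi t)) =
  (fun t => g (a + RtoC p * expi t)).
  by apply/funext => t; rewrite /g [a + _ - a]addrC addKr.
rewrite gE; apply: (@circle_mean _ g a d r) => //.
- move=> z /andP[z0 zr]; have [d' dd'] := dh z zr; eexists.
  have dn := cdiffD dd' (cdiff_cst (- h a) z).
  have za : z + - a != 0 by rewrite -cmod_gt0.
  exact: cdiffM dn (@cdiffV _ (fun w => w + - a) z _ za (cdiffD (cdiff_id z) (cdiff_cst (- a) z))).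
- case: da => q [hq qd cq] e e0.
  have [r' r'0 hr] := (ccont_cmod q a).1 cq e e0.
  exists r' => // z /andP[z0 zr]; rewrite /g hq addrAC subrr add0r mulfK -?cmod_gt0//.
  by rewrite -qd; exact: hr.
Qed.

(** Injectivity keeps the denominator away from 0 off the centre, so the inverse quotient is
    holomorphic in the punctured disc, and [d != 0] gives it a limit there. *)
Lemma inv_deriv_circle_mean h a d (r p : R) : 0 < p < r -> d != 0 ->
  (forall z, cmod (z - a) < r -> exists d', cdiff h z d') -> cdiff h a d ->
  (forall z, 0 < cmod (z - a) < r -> h z != h a) ->
  Cint (fun t => (RtoC p * expi t) / (h (a + RtoC p * expi t) - h a)) 0 tau =
  d^-1 * RtoC tau.
Proof.
move=> pr d0 dh da hinj.
pose g z := (z - a) / (h z - h a).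
have gE : (fun t => (RtoC p * expi t) / (h (a + RtoC p * expi t) - h a)) =
  (fun t => g (a + RtoC p * expi t)).
  by apply/funext => t; rewrite /g [a + _ - a]addrC addKr.
rewrite gE; apply: (@circle_mean _ g a d^-1 r) => //.
- move=> z /andP[z0 zr]; have [d' dd'] := dh z zr; eexists.
  have dn := cdiffD dd' (cdiff_cst (- h a) z).
  have za : h z + - h a != 0 by rewrite subr_eq0 hinj// z0.
  exact: cdiffM (cdiffD (cdiff_id z) (cdiff_cst (- a) z)) (@cdiffV _ (fun w => h w + - h a) z _ za dn).
- case: da => q [hq qd cq] e e0.
  have qa : q a != 0 by rewrite qd.
  have [r' r'0 hr] := (ccont_cmod _ a).1 (@cvgCV _ _ q a qa cq) e e0.
  exists r' => // z /andP[z0 zr]; rewrite /g hq addrAC subrr add0r.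
  have za : z - a != 0 by rewrite -cmod_gt0.
  rewrite invfM mulrCA mulrV ?unitfE// mulr1 -qd; exact: hr.
Qed.

(* By the two formulas above h' is continuous while 1 / h' stays bounded near z0;
   hence h' z0 = 0 would force h' = 0 near z0. *)
Lemma inj_deriv_neq0 h k z0 d (r : R) : 0 < r ->
  (forall z, cmod (z - z0) < r -> exists d', cdiff h z d') ->
  (forall z, cmod (z - z0) < r -> k (h z) = z) ->
  ccont k (h z0) -> cdiff h z0 d -> d != 0.
Proof.
move=> r0 dh kh ck d0; apply/eqP => d00; rewrite {}d00 in d0.
have hz0 : cmod (z0 - z0) < r by rewrite subrr cmod0.
(* For [a] within r / 8 of [z0], the disc of radius 3r / 4 around [a] contains the circle of radius
   [p] and stays inside the given disc around [z0]. *)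
pose p := r / 2.
have p0 : 0 < p by rewrite /p; lra.
have pr a : cmod (a - z0) < r / 8 -> 0 < p < 3 / 4 * r.
  by move=> _; rewrite /p; apply/andP; split; lra.
have sub a : cmod (a - z0) < r / 8 -> forall z, cmod (z - a) < 3 / 4 * r -> cmod (z - z0) < r.
  by move=> ar z zr; apply: le_lt_trans (cmodD3 z a z0) _; lra.
have cE (t : R) : cmod (RtoC p * expi t) = p.
  by rewrite cmodM cmod_expi mulr1 cmodRtoC gtr0_norm.
have inj a : cmod (a - z0) < r / 8 -> forall z, 0 < cmod (z - a) < 3 / 4 * r -> h z != h a.
  move=> ar z /andP[za zr]; apply/eqP => hza.
  have ar' : cmod (a - z0) < r by lra.
  by move: za; rewrite -(kh z (sub a ar z zr)) hza (kh a ar') subrr cmod0 ltxx.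
have [dl dl0 hdl] := (ccont_cmod k _).1 ck (r / 8) ltac:(lra).
have [r1 r10 h1] := (ccont_cmod h z0).1 (cdiff_continuous d0) (dl / 2) ltac:(lra).
(* If this value were smaller, h (a + p e^(it)) would lie within [dl] of h z0, and continuity of [k]
   would put a + p e^(it) within r / 8 of [z0]. Then p = r / 2 would be less than r / 8 + r / 8. *)
have low a (t : R) : cmod (a - z0) < Num.min r1 (r / 8) ->
    dl / 2 <= cmod (h (a + RtoC p * expi t) - h a).
  rewrite lt_min => /andP[ar1 ar8]; rewrite leNgt; apply/negP => bad.
  have az : cmod (a + RtoC p * expi t - a) < 3 / 4 * r.
    by rewrite addrC addKr cE /p; lra.
  have : cmod (h (a + RtoC p * expi t) - h z0) < dl.
    apply: le_lt_trans (cmodD3 _ (h a) _) _; have := h1 a ar1; lra.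
  move=> /hdl; rewrite (kh _ (sub a ar8 _ az)) (kh _ hz0) => small.
  have := cE t; rewrite (_ : RtoC p * expi t = (a + RtoC p * expi t - z0) + (z0 - a)); last by ring.
  move=> pE; have := cmodD (a + RtoC p * expi t - z0) (z0 - a).
  by rewrite pE [cmod (z0 - a)]cmodB /p; lra.
have T0 := tau_gt0.
have Te : cmod (RtoC tau) = tau by rewrite cmodRtoC gtr0_norm.
have ct a (t : R) : ccont (fun t => a + RtoC p * expi t) t.
  exact: cvgCD (cvgC_cst t a) (cvgCM (cvgC_cst t _) (@ccont_expi R t)).
have cht a : cmod (a - z0) < r / 8 -> rcont (fun t => h (a + RtoC p * expi t)).
  move=> ar t; apply: (cvgC_comp (ct a t)).
  have [|d' dd'] := dh (a + RtoC p * expi t); last exact: cdiff_continuous dd'.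
  by apply: (sub a ar); rewrite addrC addKr cE /p; lra.
have ce (t : R) : ccont (fun t => RtoC p * expi t) t.
  exact: cvgCM (cvgC_cst t _) (@ccont_expi R t).
have en0 (t : R) : RtoC p * expi t != 0 by rewrite -cmod_gt0 cE.
(* By [low] the inverse quotient is at most 2p / dl on the circle, so its mean 1 / d' is at most 4p
   / dl in modulus, including the factor 2 of [Cint_le]. *)
have lower a d' : cmod (a - z0) < Num.min r1 (r / 8) -> cdiff h a d' -> d' != 0 ->
    dl / (4 * p) <= cmod d'.
  move=> ar dd' d'0; have ar8 : cmod (a - z0) < r / 8.
    by move: ar; rewrite lt_min => /andP[].
  have dha z : cmod (z - a) < 3 / 4 * r -> exists d', cdiff h z d'.
    by move=> za; apply: dh; exact: sub za.
  have := inv_deriv_circle_mean (pr a ar8) d'0 dha dd' (inj a ar8).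
  move=> eq; have : cmod (Cint (fun t => (RtoC p * expi t) /
      (h (a + RtoC p * expi t) - h a)) 0 tau) <= 2 * (2 * p / dl) * (tau - 0).
    apply: Cint_le; [|exact: ltW|].
      move=> t; apply: (cvgCM (ce t)).
      apply: (@cvgCV _ _ (fun t => h (a + RtoC p * expi t) - h a)).
        have := low a t ar; rewrite -cmod_gt0; lra.
      exact: cvgCB (cht a ar8 t) (cvgC_cst t _).
    move=> t _; rewrite cmodM cmodV cE.
    have lo := low a t ar.
    rewrite ler_pdivrMr; last by lra.
    have : 1 <= 2 / dl * cmod (h (a + RtoC p * expi t) - h a).
      by rewrite mulrAC ler_pdivlMr// mul1r; lra.
    rewrite (_ : 2 * p / dl * _ = p * (2 / dl * cmod (h (a + RtoC p * expi t) - h a))).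
      by move=> le1; rewrite -[leLHS]mulr1 ler_pM2l.
    by field; rewrite gt_eqF.
  rewrite eq cmodM Te cmodV subr0 ler_pM2r// => le2.
  have d'p : 0 < cmod d' by rewrite cmod_gt0.
  rewrite ler_pdivrMr ?mulr_gt0//.
  have : 1 <= 2 * (2 * p / dl) * cmod d' by rewrite -ler_pdivrMr// mul1r.
  rewrite (_ : 2 * _ * _ = cmod d' * (4 * p) / dl); last by field; rewrite gt_eqF.
  by rewrite ler_pdivlMr// mul1r.
(* Comparing the means around [a] and [z0] will give |d'| <= 4 e / p, while [lower] gives |d'| >= dl
   / (4p) = 8 e / p if d' is not 0. *)
pose e := dl / (4 * p) / 8 * p.
have e0 : 0 < e by rewrite /e !mulr_gt0 ?invr_gt0 ?mulr_gt0.
have z08 : cmod (z0 - z0) < r / 8 by rewrite subrr cmod0; lra.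
have [r2 r20 h2] := @circle_tube h z0 p e e0 (fun t => ltac:(
  have [|d' dd'] := dh (z0 + RtoC p * expi t); [by rewrite addrC addKr cE /p; lra|exact: cdiff_continuous dd'])).
have [r3 r30 h3] := (ccont_cmod h z0).1 (cdiff_continuous d0) e e0.
pose r' := Num.min (Num.min r1 (r / 8)) (Num.min r2 r3).
have r'0 : 0 < r' by rewrite /r' !lt_min r10 r20 r30 /= andbT; lra.
have dz a : cmod (a - z0) < r' -> cdiff h a 0.
  rewrite /r' lt_min => /andP[ar]; rewrite lt_min => /andP[ar2 ar3].
  have ar8 : cmod (a - z0) < r / 8 by move: ar; rewrite lt_min => /andP[].
  have [|d' dd'] := dh a; first by lra.
  have [<-//|d'0] := eqVneq d' 0; exfalso.
  have dha b : cmod (b - z0) < r / 8 -> forall z, cmod (z - b) < 3 / 4 * r -> exists d', cdiff h z d'.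
    by move=> br z zb; apply: dh; exact: sub zb.
  have eq1 := deriv_circle_mean (pr a ar8) (dha a ar8) dd'.
  have eq2 := deriv_circle_mean (pr z0 z08) (dha z0 z08) d0.
  pose G b t := (h (b + RtoC p * expi t) - h b) / (RtoC p * expi t).
  have cG b : cmod (b - z0) < r / 8 -> rcont (G b).
    move=> br t; apply: (cvgCM (cvgCB (cht b br t) (cvgC_cst t _))).
    by apply: (@cvgCV _ _ (fun t => RtoC p * expi t)).
  have eq3 : Cint (fun t => G a t + (-1) * G z0 t) 0 tau = d' * RtoC tau.
    rewrite CintD; [|exact: cG|by move=> t; exact: cvgCM (cvgC_cst t _) (cG z0 z08 t)].
    rewrite CintZ; last exact: cG.
    by rewrite /G eq1 eq2 mul0r mulr0 addr0.
  have : cmod (Cint (fun t => G a t + (-1) * G z0 t) 0 tau) <= 2 * (2 * e / p) * (tau - 0).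
    apply: Cint_le; [|exact: ltW|].
      by move=> t; exact: cvgCD (cG a ar8 t) (cvgCM (cvgC_cst t _) (cG z0 z08 t)).
    move=> t tt; rewrite (_ : G a t + _ =
      ((h (a + RtoC p * expi t) - h (z0 + RtoC p * expi t)) - (h a - h z0)) /
      (RtoC p * expi t)); last first.
      by rewrite /G; ring.
    rewrite cmodM cmodV cE ler_pM2r ?invr_gt0//.
    apply: le_trans (cmodD _ _) _; rewrite cmodN.
    have := h2 a ar2 t tt; have := h3 a ar3; lra.
  rewrite eq3 cmodM Te subr0 ler_pM2r// => up.
  have := lower a d' ar dd' d'0.
  have -> : dl / (4 * p) = 8 * (e / p).
    by rewrite /e; field; rewrite gt_eqF.
  have : 0 < e / p by rewrite divr_gt0.
  lra.
(* So [h] is constant near [z0], which its left inverse [k] forbids: [z1] is another point with the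
   same value. *)
have hc := deriv0_cst dz.
pose z1 := z0 + RtoC (r' / 2).
have c1 : cmod (z1 - z0) = r' / 2.
  by rewrite /z1 addrC addKr cmodRtoC gtr0_norm// divr_gt0.
have r'r : r' < r.
  have : r' <= r / 8 by rewrite /r' !ge_min lexx orbT.
  lra.
have hz1 : h z1 = h z0 by apply: hc; rewrite c1; lra.
have e1 := kh z1 ltac:(rewrite c1; lra).
have e2 := kh z0 hz0.
have e12 : z1 = z0 by rewrite -e1 hz1 e2.
by move: c1; rewrite e12 subrr cmod0 => c1; have : 0 < r' / 2 by [lra]; rewrite -c1 ltxx.
Qed.

(** Evaluating the slope identity of [h] at k w gives w - h z0 = q (k w) (k w - z0), so 1 / q (k w)
    is a slope for [k]; it is continuous at h z0 because q z0 = d is not 0. *)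
Lemma cdiff_inverse h k z0 d (r : R) : 0 < r ->
  (forall z, cmod (z - z0) < r -> exists d', cdiff h z d') ->
  (forall z, cmod (z - z0) < r -> k (h z) = z) ->
  ccont k (h z0) -> cdiff h z0 d ->
  (\forall w \near h z0, h (k w) = w) -> cdiff k (h z0) d^-1.
Proof.
move=> r0 dh kh ck dd hk; have d0 := inj_deriv_neq0 r0 dh kh ck dd.
have kz0 : k (h z0) = z0 by apply: kh; rewrite subrr cmod0.
case: dd => q [hq qd cq].
have cqk : ccont (fun w => q (k w)) (h z0) by apply: (cvgC_comp ck); rewrite kz0.
have qk0 : q (k (h z0)) != 0 by rewrite kz0 qd.
apply: (@cdiff_near _ (fun w => z0 + (q (k w))^-1 * (w - h z0))).
  have /ccont_cmod/(_ (cmod (q (k (h z0)))))[|r' r'0 hr] := cqk.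
    by rewrite cmod_gt0.
  have nq : \forall w \near h z0, q (k w) != 0.
    apply/nbhs_cmod; exists r' => // w /hr; apply: contraTneq => ->.
    by rewrite sub0r cmodN ltxx.
  apply: filterS2 hk nq => w hkw qw.
  rewrite -{2}hkw (hq (k w)) [h z0 + _ - _]addrC addKr mulrA mulVf// mul1r subrKC//.
exists (fun w => (q (k w))^-1); split.
- by move=> w; rewrite subrr mulr0 addr0.
- by rewrite kz0 qd.
- exact: (@cvgCV _ _ (fun w => q (k w))).
Qed.

End InverseHolomorphic.

(** * Generic series in A(Omega) *)

Section DiscAlgebra.
Variable R : realType.
Local Notation C := (Cx R).
Implicit Types (A Om : set C) (f g : C -> C) (z w : C).

Definition wcont A f := forall z, A z -> forall e : R, 0 < e ->
  exists2 r : R, 0 < r & forall w, A w -> cmod (w - z) < r -> cmod (f w - f z) < e.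

Lemma within_cmod (T : topologicalType) (A : set T) (f : T -> C) :
  {within A, continuous f} <-> forall z : T, A z -> forall e : R, 0 < e ->
    \forall w \near z, A w -> cmod (f w - f z) < e.
Proof.
split.
  move=> /subspace_continuousP cf z Az e e0.
  exact: ((@cvg_cmod _ _ (within A (nbhs z)) _ f (f z)).1 (cf z Az) e e0).
move=> cf; apply/subspace_continuousP => z Az.
by apply/(@cvg_cmod _ _ (within A (nbhs z)) _ f (f z)).2 => e; exact: cf.
Qed.

Lemma wcontP A f : {within A, continuous f} <-> wcont A f.
Proof.
split=> [/within_cmod cf z Az e e0|cf].
  by have /nbhs_cmod[r r0 h] := cf z Az e e0; exists r => // w Aw /h; exact.
apply/within_cmod => z Az e /(cf z Az)[r r0 h].
by apply/nbhs_cmod; exists r => // w wr Aw; exact: h.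
Qed.

Lemma algAP Om f : algA Om f <->
  wcont (closure Om) f /\ (forall z, Om z -> exists d, cdiff f z d).
Proof.
split=> -[cf df]; split; try by [apply/wcontP].
  by move=> z /df /derivable_cdiff.
by move=> z /df; apply: (derivable_cdiff f z).2.
Qed.

Lemma supdistP Om f g (e : R) :
  supdist_le Om f g e <-> forall z, closure Om z -> cmod (f z - g z) <= e.
Proof. by split=> h z /h; rewrite normE RtoC_le. Qed.

Lemma wcontD A f g : wcont A f -> wcont A g -> wcont A (fun z => f z + g z).
Proof.
move=> cf cg z Az e e0.
have [r1 r10 h1] := cf z Az (e / 2) ltac:(by rewrite divr_gt0).
have [r2 r20 h2] := cg z Az (e / 2) ltac:(by rewrite divr_gt0).
exists (Num.min r1 r2); first by rewrite lt_min r10.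
move=> w Aw; rewrite lt_min => /andP[w1 w2]; rewrite opprD addrACA.
by apply: le_lt_trans (cmodD _ _) _; have := h1 w Aw w1; have := h2 w Aw w2; lra.
Qed.

Lemma wcontM A f g : wcont A f -> wcont A g -> wcont A (fun z => f z * g z).
Proof.
move=> /wcontP cf /wcontP cg; apply/wcontP.
have cc (h : C -> C) : {within A, continuous h} -> forall z, @ccont R (subspace A) h z.
  by move=> ch z; apply/ccontP; exact: ch.
move=> z; apply/(@ccontP R (subspace A)); exact: (@cvgCM R (subspace A) f g z (cc f cf z) (cc g cg z)).
Qed.

Lemma wcont_cst A (c : C) : wcont A (fun=> c).
Proof. by move=> z _ e e0; exists 1 => // w _ _; rewrite subrr cmod0. Qed.

Lemma wcontX A f N : wcont A f -> wcont A (fun z => f z ^+ N).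
Proof.
move=> cf; elim: N => [|N ih]; first exact: wcont_cst.
by under eq_fun do rewrite exprS; exact: wcontM cf ih.
Qed.

Lemma algA_addX Om f k c N : algA Om f -> algA Om k ->
  algA Om (fun z => f z + c * k z ^+ N).
Proof.
move=> /algAP[cf df] /algAP[ck dk]; apply/algAP; split.
  exact: wcontD cf (wcontM (wcont_cst _) (wcontX N ck)).
move=> z Oz; have [d dd] := df z Oz; have [d' dd'] := dk z Oz.
have [d'' dX] := cdiffX N dd'.
by eexists; exact: cdiffD dd (cdiffM (cdiff_cst c z) dX).
Qed.

(** The recursion for x^N - y^N turns a constant L into r L + 1, and 1 / (1 - r) is the fixed point.
    Hence the constant does not grow with N. *)
Lemma lip_exp (x y : C) (r : R) N : 0 <= r < 1 -> cmod x <= r -> cmod y <= r ->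
  cmod (x ^+ N - y ^+ N) <= cmod (x - y) / (1 - r).
Proof.
move=> /andP[r0 r1] xr yr; have d0 := cmod_ge0 (x - y).
have q0 : 0 < 1 - r by lra.
elim: N => [|N ih]; first by rewrite !expr0 subrr cmod0 divr_ge0// ltW.
rewrite (_ : _ - _ = x * (x ^+ N - y ^+ N) + (x - y) * y ^+ N); last by rewrite !exprS; ring.
apply: le_trans (cmodD _ _) _; rewrite !cmodM cmodX.
have p1 : cmod x * cmod (x ^+ N - y ^+ N) <= r * (cmod (x - y) / (1 - r)).
  by apply: ler_pM => //; exact: cmod_ge0.
have p2 : cmod (x - y) * cmod y ^+ N <= cmod (x - y) * 1.
  by rewrite ler_wpM2l// exprn_ile1 ?cmod_ge0//; lra.
apply: le_trans (lerD p1 p2) _.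
by rewrite le_eqVlt; apply/orP; left; apply/eqP; field; rewrite gt_eqF.
Qed.

(** The bound on the increments says exactly that the intervals of radius [e m] around each
    coordinate are nested. The two coordinates together give the factor 2. *)
Lemma cauchy_limit (x : nat -> C) (e : nat -> R) : (forall m, 0 <= e m) ->
  (forall m, cmod (x m.+1 - x m) <= e m - e m.+1) ->
  exists l, forall m, cmod (l - x m) <= 2 * e m.
Proof.
move=> e0 xe.
have lim (u : nat -> R) : (forall m, `|u m.+1 - u m| <= e m - e m.+1) ->
    exists l, forall m, `|l - u m| <= e m.
  move=> ue; have [||| l hl] := @nested_intervals R (fun m => u m - e m) (fun m => 2 * e m).
  - by move=> m; rewrite mulr_ge0.
  - by move=> m; have := ue m; rewrite ler_norml => /andP[]; lra.
  - by move=> m; have := ue m; rewrite ler_norml => /andP[]; lra.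
  by exists l => m; have := hl m; rewrite ler_norml => /andP[? ?]; apply/andP; split; lra.
have [a ha] := lim (fun m => complex.Re (x m)) (fun m => ltac:(
  by rewrite -cxReN -cxReD; apply: le_trans (cmod_Re _) (xe m))).
have [b hb] := lim (fun m => complex.Im (x m)) (fun m => ltac:(
  by rewrite -cxImN -cxImD; apply: le_trans (cmod_Im _) (xe m))).
exists (a +i* b)%C => m; apply: le_trans (cmod_ReIm _) _.
rewrite cxReD cxImD cxReN cxImN /=; have := ha m; have := hb m; lra.
Qed.

Lemma cdiff_lip f z d (M : R) : cdiff f z d ->
  (\forall w \near z, cmod (f w - f z) <= M * cmod (w - z)) -> cmod d <= M.
Proof.
move=> df /nbhs_cmod[r r0 hr]; apply/ler_addgt0Pl => e e0.
have [r' r'0 h] := cdiff_le df e0.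
pose s := Num.min (r / 2) (r' / 2).
have s0 : 0 < s by rewrite lt_min !divr_gt0.
have sr : s < r by have : s <= r / 2 by [rewrite ge_min lexx]; lra.
have sr' : s < r' by have : s <= r' / 2 by [rewrite ge_min lexx orbT]; lra.
pose w := z + RtoC s; have wz : w - z = RtoC s by rewrite /w addrC addKr.
have ws : cmod (w - z) = s by rewrite wz cmodRtoC gtr0_norm.
have h1 := h w; have h2 := hr w; rewrite ws in h1 h2.
have {}h1 := h1 sr'; have {}h2 := h2 sr.
rewrite -(ler_pM2r s0) -{1}ws -cmodM.
rewrite (_ : d * (w - z) = (f w - f z) - (f w - f z - d * (w - z))); last by ring.
by apply: le_trans (cmodD _ _) _; rewrite cmodN mulrDl; lra.
Qed.

End DiscAlgebra.

Section GenericSeries.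
Variable R : realType.
Local Notation C := (Cx R).
Variables (Om : set C) (n : nat) (k : nat -> C -> C).
Hypotheses (oOm : open Om) (kA : forall i, (i < n)%N -> algA Om (k i))
  (kle1 : forall i, (i < n)%N -> forall z, closure Om z -> cmod (k i z) <= 1)
  (klt1 : forall i, (i < n)%N -> forall z, Om z -> cmod (k i z) < 1).

Lemma powers_lipschitz z0 : Om z0 -> exists M r : R, [/\ 0 < M, 0 < r &
  forall i N, (i < n)%N -> forall w, cmod (w - z0) < r ->
    cmod (k i w ^+ N - k i z0 ^+ N) <= M * cmod (w - z0)].
Proof.
move=> Oz; move: kA klt1; clear kle1; elim: n => [|m ih] kA' klt'.
  by exists 1, 1; split.
have [|i im z|M [r [M0 r0 hM]]] := ih; [by move=> i im; apply/kA'/ltnW|exact/klt'/ltnW|].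
have /algAP[_ /(_ z0 Oz)[d dd]] := kA' m (ltnSn m).
have km := klt' m (ltnSn m) z0 Oz; have k0 := cmod_ge0 (k m z0).
(* The midpoint between |k m z0| and 1 bounds |k m| near [z0]; there [k m] itself is Lipschitz
   relative to [z0] with constant 1 + |d|. *)
pose q := (1 + cmod (k m z0)) / 2.
have q0 : 0 <= q by rewrite /q; lra.
have q1 : q < 1 by rewrite /q; lra.
have kq : cmod (k m z0) < q by rewrite /q; lra.
have [r1 r10 h1] := (ccont_cmod _ z0).1 (cdiff_continuous dd) (q - cmod (k m z0)) ltac:(by rewrite subr_gt0).
have [r2 r20 h2] := cdiff_le dd ltr01.
have D0 := cmod_ge0 d.
exists (Num.max M ((1 + cmod d) / (1 - q))), (Num.min r (Num.min r1 r2)); split.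
- by rewrite lt_max M0.
- by rewrite !lt_min r0 r10.
move=> i N; rewrite ltnS => im w; rewrite !lt_min => /and3P[wr wr1 wr2].
have w0 := cmod_ge0 (w - z0).
move: im; rewrite leq_eqVlt => /orP[/eqP->|im]; last first.
  by apply: le_trans (hM i N im w wr) _; rewrite ler_wpM2r// le_max lexx.
have kw : cmod (k m w) <= q.
  rewrite -[k m w](subrK (k m z0)); apply: le_trans (cmodD _ _) _.
  by have := h1 w wr1; lra.
apply: le_trans (lip_exp N _ kw (ltW kq)) _; first by rewrite q0.
apply: (@le_trans _ _ ((1 + cmod d) / (1 - q) * cmod (w - z0))); last first.
  by rewrite ler_wpM2r// le_max lexx orbT.
rewrite mulrAC ler_pM2r ?invr_gt0 ?subr_gt0//.
rewrite (_ : k m w - k m z0 = (k m w - k m z0 - d * (w - z0)) + d * (w - z0)); last by ring.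
apply: le_trans (cmodD _ _) _; rewrite cmodM mulrDl mul1r.
by have := h2 w wr2; rewrite mul1r; lra.
Qed.

(** The usual nested balls, with all corrections of the form c k_i^N. By [powers_lipschitz] the tail
    F (m + j) - F m has at each point of [Om] a Lipschitz constant at most M e m, so the derivatives
    converge and the difference quotients of the limit are controlled by those of a single F m. The
    coefficient c may be 0, which covers conditions that hold already. *)
Lemma dense_bigcap (T : nat -> set (C -> C)) :
  (forall m, A_open Om (T m)) ->
  (forall m f (a : R), algA Om f -> 0 < a -> exists i N c,
     [/\ (i < n)%N, 0 <= c <= a & T m (fun z => f z + RtoC c * k i z ^+ N)]) ->
  forall f (e : R), algA Om f -> 0 < e ->
    exists g, [/\ algA Om g, forall m, T m g & supdist_le Om f g e].
Proof.
move=> oT dT f eps fA eps0.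
(* A state is a function with a radius. The ball required inside [T m] has twice the radius because
   [cauchy_limit] locates the limit only up to [2 * e m]; for the same reason the first radius will
   be [eps / 2]. *)
pose Step m (s s' : (C -> C) * R) := [/\ algA Om s'.1, 0 < s'.2, s'.2 <= s.2 / 2,
   (forall g, algA Om g -> supdist_le Om s'.1 g (2 * s'.2) -> T m g) &
   exists i N c, [/\ (i < n)%N, 0 <= c <= s.2 / 2 &
     s'.1 = (fun z => s.1 z + RtoC c * k i z ^+ N)]].
have step (x : nat * ((C -> C) * R)) : exists s',
    algA Om x.2.1 -> 0 < x.2.2 -> Step x.1 x.2 s'.
  case: x => m [F e] /=.
  have [FA|] := pselect (algA Om F); last by exists (F, e).
  have [e0|] := ltP 0 e; last by exists (F, e).
  have [i [N [c [ci ca Tm]]]] := dT m F (e / 2) FA ltac:(by rewrite divr_gt0).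
  have FA' := algA_addX (RtoC c) N FA (kA ci).
  have [e' e'0 he'] := oT m _ FA' Tm.
  exists ((fun z => F z + RtoC c * k i z ^+ N), Num.min (e' / 2) (e / 2)) => _ _.
  split=> //=.
  - by rewrite lt_min !divr_gt0.
  - by rewrite ge_min lexx orbT.
  - move=> g gA /supdistP hg; apply: he' => //; apply/supdistP => z /hg hz.
    apply: le_trans hz _.
    have : Num.min (e' / 2) (e / 2) <= e' / 2 by rewrite ge_min lexx.
    lra.
  - by exists i, N, c.
have [G GP] := choice step.
pose s := nat_rect (fun=> ((C -> C) * R)%type) (f, eps / 2) (fun m x => G (m, x)).
have sA m : algA Om (s m).1 /\ 0 < (s m).2.
  elim: m => [|m [ih1 ih2]]; first by split => //=; rewrite divr_gt0.
  by have [] := GP (m, s m) ih1 ih2.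
have sP m : Step m (s m) (s m.+1) by have [a b] := sA m; exact: GP.
pose F m := (s m).1; pose e m := (s m).2.
have e0 m : 0 < e m by have [] := sA m.
have eS m : e m.+1 <= e m / 2 by have [] := sP m.
have e2 m : e m <= e 0%N / 2 ^+ m.
  elim: m => [|m ih]; first by rewrite expr0 divr1.
  apply: le_trans (eS m) _; rewrite exprS invfM mulrCA.
  by rewrite [leRHS]mulrC ler_pM2r ?invr_gt0.
have esmall (x : R) : 0 < x -> exists m, e m < x.
  move=> x0; have [m hm] : exists m : nat, e 0%N / x < m%:R.
    by exists (Num.truncn (e 0%N / x)).+1; rewrite truncnS_gt.
  exists m; apply: le_lt_trans (e2 m) _; rewrite ltr_pdivrMr ?exprn_gt0// mulrC -ltr_pdivrMr//.
  by apply: lt_trans hm _; rewrite -natrX ltr_nat ltn_expl.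
have FS m : exists i N c, [/\ (i < n)%N, 0 <= c <= e m / 2 &
     F m.+1 = (fun z => F m z + RtoC c * k i z ^+ N)] by have [] := sP m.
have limF z : exists l, closure Om z -> forall m, cmod (l - F m z) <= 2 * e m.
  have [cz|] := pselect (closure Om z); last by exists 0.
  have [|m|l hl] := @cauchy_limit R (fun m => F m z) e; [by move=> m; exact: ltW| |by exists l].
  have [i [N [c [ci /andP[c0 ce] ->]]]] := FS m.
  rewrite addrC addKr cmodM cmodRtoC ger0_norm// cmodX.
  have : c * cmod (k i z) ^+ N <= c * 1.
    by rewrite ler_wpM2l// exprn_ile1 ?cmod_ge0// kle1.
  by have := eS m; lra.
have [g gP] := choice limF.
have gdist m : supdist_le Om (F m) g (2 * e m).
  by apply/supdistP => z cz; rewrite cmodB; exact: gP.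
have gA : algA Om g.
  apply/algAP; split.
    move=> z cz x x0; have [m hm] := esmall (x / 8) ltac:(by rewrite divr_gt0).
    have /algAP[cF _] := (sA m).1.
    have [r r0 hr] := cF z cz (x / 2) ltac:(by rewrite divr_gt0).
    exists r => // w cw wr.
    apply: le_lt_trans (cmodD3 _ (F m w) _) _.
    apply: le_lt_trans (lerD (lexx _) (cmodD3 _ (F m z) _)) _.
    have h1 := gP w cw m; have h2 := gP z cz m; have h3 := hr w cw wr.
    by rewrite [cmod (F m z - g z)]cmodB; rewrite -/(F m) in h3; lra.
  move=> z0 Oz; have cz0 : closure Om z0 by exact: subset_closure.
  have [M [r [M0 r0 hM]]] := powers_lipschitz Oz.
  have dF m : exists d, cdiff (F m) z0 d.
    by have /algAP[_ dF] := (sA m).1; exact: dF.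
  (* Since radii at least halve, c <= e m / 2 <= e m - e (m + 1); in this form the bounds
     telescope. *)
  have lipS m w : cmod (w - z0) < r ->
      cmod ((F m.+1 w - F m w) - (F m.+1 z0 - F m z0)) <= (e m - e m.+1) * M * cmod (w - z0).
    move=> wr; have [i [N [c [ci /andP[c0 ce] ->]]]] := FS m.
    rewrite [F m w + _ - _]addrC addKr [F m z0 + _ - _]addrC addKr -mulrBr cmodM cmodRtoC ger0_norm//.
    rewrite -mulrA; apply: ler_pM => //; [exact: cmod_ge0|by have := eS m; lra|exact: hM].
  have lip m j w : cmod (w - z0) < r ->
      cmod ((F (m + j)%N w - F m w) - (F (m + j)%N z0 - F m z0)) <=
      (e m - e (m + j)%N) * M * cmod (w - z0).
    move=> wr; elim: j => [|j ih]; first by rewrite addn0 !subrr cmod0 !mul0r.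
    rewrite addnS [X in cmod X](_ : _ = ((F (m + j).+1 w - F (m + j)%N w) - (F (m + j).+1 z0 - F (m + j)%N z0)) +
      ((F (m + j)%N w - F m w) - (F (m + j)%N z0 - F m z0))); last by ring.
    apply: le_trans (cmodD _ _) _; apply: le_trans (lerD (lipS _ _ wr) ih) _.
    rewrite -!mulrDl (_ : (e (m + j)%N - e (m + j).+1) + (e m - e (m + j)%N) =
      e m - e (m + j).+1)//; ring.
  have [d dP] := choice dF.
  have [|m|D hD] := @cauchy_limit R d (fun m => e m * M); first by move=> m; rewrite mulr_ge0 ?ltW.
    rewrite -mulrBl; apply: (@cdiff_lip _ (fun w => F m.+1 w + (-1) * F m w) z0).
      have := cdiffD (dP m.+1) (cdiffM (cdiff_cst (-1) z0) (dP m)).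
      by rewrite mul0r add0r mulN1r.
    apply/nbhs_cmod; exists r => // w wr; rewrite !mulN1r; exact: lipS.
  have lipg m w : cmod (w - z0) < r -> closure Om w ->
      cmod ((g w - F m w) - (g z0 - F m z0)) <= e m * M * cmod (w - z0).
    move=> wr cw; apply/ler_addgt0Pl => x x0.
    (* The limit is approximated at the two points [w] and [z0], each within 2 e (m + j) < x / 2. *)
    have [p hp] := esmall (x / 4) ltac:(by rewrite divr_gt0).
    have [j jP] : exists j, e (m + j)%N < x / 4.
      exists p; apply: le_lt_trans hp; rewrite addnC; elim: (m) => [|m' ih']; first by rewrite addn0.
      by rewrite addnS; apply: le_trans (eS _) _; have := e0 (p + m')%N; lra.
    rewrite (_ : _ - _ = (g w - F (m + j)%N w) - (g z0 - F (m + j)%N z0) +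
       ((F (m + j)%N w - F m w) - (F (m + j)%N z0 - F m z0))); last by ring.
    apply: le_trans (cmodD _ _) _; apply: le_trans (lerD (cmodD _ _) (lip m j w wr)) _.
    rewrite cmodN; have h1 := gP w cw (m + j)%N; have h2 := gP z0 cz0 (m + j)%N.
    have : (e m - e (m + j)%N) * M * cmod (w - z0) <= e m * M * cmod (w - z0).
      rewrite ler_wpM2r ?cmod_ge0// ler_wpM2r ?ltW//; have := e0 (m + j)%N; lra.
    lra.
  exists D; apply: le_cdiff => x x0.
  (* Three errors are added: x / 8 for the tail, x / 2 for the difference quotient of F m, and 2 x /
     8 for replacing d m by D. *)
  have [m hm] := esmall (x / (8 * M)) ltac:(by rewrite divr_gt0// mulr_gt0).
  have emM : e m * M < x / 8.
    by move: hm; rewrite ltr_pdivlMr ?mulr_gt0//; lra.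
  have [r1 r10 h1] := cdiff_le (dP m) (divr_gt0 x0 (ltr0Sn R 1)).
  have /nbhs_cmod[r2 r20 h2] : nbhs z0 Om by exact: open_nbhs_nbhs.
  exists (Num.min r (Num.min r1 r2)); first by rewrite !lt_min r0 r10.
  move=> w; rewrite !lt_min => /and3P[wr wr1 wr2].
  have cw : closure Om w by exact/subset_closure/h2.
  rewrite (_ : _ - _ - _ = ((g w - F m w) - (g z0 - F m z0)) +
    ((F m w - F m z0 - d m * (w - z0)) + - ((D - d m) * (w - z0)))); last by ring.
  apply: le_trans (cmodD _ _) _; apply: le_trans (lerD (lipg m w wr cw) (cmodD _ _)) _.
  rewrite cmodN cmodM; have w0 := cmod_ge0 (w - z0).
  have k1 := h1 w wr1.
  have k2 : cmod (D - d m) * cmod (w - z0) <= 2 * (e m * M) * cmod (w - z0).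
    by rewrite ler_wpM2r.
  have k3 : e m * M * cmod (w - z0) <= x / 8 * cmod (w - z0).
    by rewrite ler_wpM2r// ltW.
  have k4 : 0 <= x * cmod (w - z0) by rewrite mulr_ge0// ltW.
  lra.
exists g; split => //.
- move=> m; have [_ _ _ hT _] := sP m; apply: hT => //; exact: gdist.
- by have := gdist 0%N; rewrite /e/= mulrC divfK.
Qed.

End GenericSeries.

(** * Oscillating periodic functions *)

Section Oscillation.
Variable R : realType.
Local Notation tau := (pi *+ 2 : R).
Implicit Types (u v : R -> R) (m : nat) (t y : R).

Lemma periodic_ind (T : R) (P : R -> Prop) : 0 < T ->
  (forall t, P t <-> P (t + T)) ->
  (forall t, 0 <= t <= T -> P t) -> forall t, P t.
Proof.
move=> T0 PT P0.
have Pn n t : P t <-> P (t + T *+ n).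
  elim: n t => [|n ih] t; first by rewrite mulr0n addr0.
  by rewrite mulrS [T + _]addrC addrA -PT.
have pos t : 0 <= t -> P t.
  move=> t0; have := truncn_itv (divr_ge0 t0 (ltW T0)).
  move: (Num.truncn _) => n /andP[n1 n2].
  have -> : t = (t - T *+ n) + T *+ n by rewrite subrK.
  apply: (Pn n (t - T *+ n)).1; apply: P0; rewrite -[T *+ n]mulr_natl.
  move: n1 n2; rewrite ler_pdivlMr// ltr_pdivrMr// -natr1 mulrDl mul1r => n1 n2.
  by rewrite subr_ge0 n1 /= lerBlDl ltW.
move=> t; have [t0|t0] := leP 0 t; first exact: pos.
have [n nt] : exists n : nat, - t / T < n%:R.
  by exists (Num.truncn (- t / T)).+1; rewrite truncnS_gt.
apply: (Pn n t).2; apply: pos; rewrite -mulr_natl; move: nt; rewrite ltr_pdivrMr// => nt.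
by rewrite -lerBlDl sub0r ltW.
Qed.

Definition osc m u := forall t, exists y,
  t < y < t + m%:R^-1 /\ m%:R * `|y - t| < `|u y - u t|.

(** The near-covering form of compactness of one period, used to make both the margin in [osc] and a
    modulus of continuity uniform. *)
Lemma tau_cover (P : R -> R -> Prop) :
  (forall t, exists2 d : R, 0 < d &
     forall s e, `|s - t| < d -> 0 < e < d -> P e s) ->
  exists2 e : R, 0 < e & forall t, 0 <= t <= tau -> P e t.
Proof.
move=> hP.
have /compact_near_coveringP cK : compact `[0, tau]%classic := @segment_compact R 0 tau.
have /nbhs_ballP[r /= r0 hr] : nbhs (0 : R) (fun e => `[0, tau]%classic `<=` (fun t => 0 < e -> P e t)).
  apply: (cK R (nbhs (0 : R)) (fun e t => 0 < e -> P e t) (nbhs_filter _)) => t _.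
  have [d d0 hd] := hP t.
  exists (ball t d, ball (0 : R) d); first by split; exact: nbhsx_ballx.
  move=> [s e] /= [] ; rewrite -!ball_normE /ball_/= sub0r normrN distrC => st ed e0.
  by apply: hd => //; rewrite e0 -[e]gtr0_norm.
exists (r / 2) => [|t t01]; first by rewrite divr_gt0.
apply: (hr (r / 2)) => //; last by rewrite divr_gt0.
by rewrite -ball_normE /ball_/= sub0r normrN gtr0_norm ?divr_gt0//; lra.
Qed.

Lemma continuous_dist u t (e : R) : continuous u -> 0 < e ->
  exists2 d : R, 0 < d & forall s, `|s - t| < d -> `|u s - u t| < e.
Proof.
move=> cu e0; have /cvgrPdist_lt/(_ e e0)/nbhs_ballP[d /= d0 hd] := cu t.
exists d => // s st; rewrite distrC; apply: hd.
by rewrite -ball_normE /ball_/= distrC.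
Qed.

(** The inequalities in [osc] are strict, so a witness for [t] serves all nearby points with some
    margin to spare. Compactness of a period yields one margin for all points, and this absorbs a
    uniformly small change of [u]. *)
Lemma osc_robust m u : continuous u -> (forall t, u (t + tau) = u t) -> osc m u ->
  exists2 e : R, 0 < e & forall v, (forall t, `|v t - u t| <= e) -> osc m v.
Proof.
move=> cu pu ou.
pose P (e t : R) := exists y, t < y < t + m%:R^-1 /\ m%:R * `|y - t| + 2 * e < `|u y - u t|.
have [e e0 he] : exists2 e : R, 0 < e & forall t, 0 <= t <= tau -> P e t.
  apply: tau_cover => t; have [y [/andP[ty yt] hy]] := ou t.
  pose gap := `|u y - u t| - m%:R * `|y - t|.
  have gap0 : 0 < gap by rewrite subr_gt0.
  have [d d0 hd] := continuous_dist t cu (divr_gt0 gap0 (ltr0Sn R 3)).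
  have M0 : 0 < 4 * (m%:R + 1) :> R by rewrite mulr_gt0// ltr_wpDl.
  (* Passing from [t] to [s] costs at most gap / 4 in the value of [u] and gap / 4 in the linear
     term, and the margin [2 * e] less than gap / 4. The last two bounds keep [y] in the window of
     [s]. *)
  pose d' := Num.min (Num.min d (gap / 8))
    (Num.min (gap / (4 * (m%:R + 1))) (Num.min (y - t) (t + m%:R^-1 - y))).
  exists d'; first by rewrite /d' !lt_min d0 !divr_gt0//= !subr_gt0 ty.
  move=> s e; rewrite /d' !lt_min => /and3P[/andP[sd _] sg /andP[sy1 sy2]].
  move=> /andP[e0 /andP[/andP[_ eg] _]].
  exists y.
  have sl := ler_norm (s - t); have sl' := ler_norm (t - s); rewrite distrC in sl'.
  split; first by apply/andP; split; lra.
  have h1 := hd s sd.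
  have h2 : `|y - s| <= `|y - t| + `|s - t|.
    by rewrite (distrC s t); exact: ler_distD.
  have h3 : `|u y - u t| <= `|u y - u s| + `|u s - u t|.
    exact: ler_distD.
  have h4 : m%:R * `|y - s| <= m%:R * `|y - t| + m%:R * `|s - t|.
    by rewrite -mulrDr ler_wpM2l.
  have h5 : m%:R * `|s - t| <= gap / 4.
    move: sg; rewrite ltr_pdivlMr//; have := normr_ge0 (s - t); lra.
  rewrite /gap in eg h5 h1 *; lra.
have he' : forall t, P e t.
  apply: (periodic_ind (tau_gt0 R)) => // t; split=> -[y [/andP[y1 y2] hy]].
    exists (y + tau); split; first by apply/andP; split; lra.
    by rewrite !pu (_ : y + tau - (t + tau) = y - t)//; ring.
  exists (y - tau); split; first by apply/andP; split; lra.
  by rewrite -(pu (y - tau)) subrK -(pu t) (_ : y - tau - t = y - (t + tau))//; ring.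
exists (e / 2) => [|v hv t]; first by rewrite divr_gt0.
have [y [yt hy]] := he' t; exists y; split => //.
have h1 := hv y; have h2 := hv t.
have h3 : `|u y - u t| <= `|u y - v y| + (`|v y - v t| + `|v t - u t|).
  by apply: le_trans (ler_distD (v y) _ _) _; rewrite lerD2l; exact: ler_distD.
rewrite (distrC (u y) (v y)) in h3; lra.
Qed.

Lemma periodic_uniform u (e : R) : continuous u -> (forall t, u (t + tau) = u t) ->
  0 < e -> exists2 d : R, 0 < d & forall t s, `|s - t| < d -> `|u s - u t| < e.
Proof.
move=> cu pu e0.
have [d d0 hd] : exists2 d : R, 0 < d &
    forall t, 0 <= t <= tau -> forall s, `|s - t| < d -> `|u s - u t| < e.
  apply: tau_cover => t.
  have [d d0 hd] := continuous_dist t cu (divr_gt0 e0 (ltr0Sn R 1)).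
  exists (d / 2); first by rewrite divr_gt0.
  move=> t' d' t't /andP[d'0 d'd] s st'.
  have h1 : `|u t' - u t| < e / 2 by apply: hd; lra.
  have h2 : `|u s - u t| < e / 2.
    apply: hd; have : `|s - t| <= `|s - t'| + `|t' - t|.
      exact: ler_distD.
    lra.
  have : `|u s - u t'| <= `|u s - u t| + `|u t - u t'|.
    exact: ler_distD.
  by rewrite (distrC (u t)); lra.
exists d => //; apply: (periodic_ind (tau_gt0 R)) => // t; split=> h s hs.
  rewrite pu -(subrK tau s) pu; apply: h.
  by rewrite (_ : s - tau - t = s - (t + tau))//; ring.
rewrite -(pu s) -(pu t); apply: h.
by rewrite (_ : s + tau - (t + tau) = s - t)//; ring.
Qed.

(* Of the two candidates at a half and a quarter period of [cos (N t)], one moves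
   the cosine by at least 1/2. *)
Lemma osc_add_cos m u (a : R) : (0 < m)%N -> continuous u ->
  (forall t, u (t + tau) = u t) -> 0 < a ->
  exists N : nat, osc m (fun t => u t + a * cos (N%:R * t)).
Proof.
move=> m0 cu pu a0.
have m0' : 0 < m%:R :> R by rewrite ltr0n.
have [d d0 hd] := periodic_uniform cu pu (divr_gt0 a0 (ltr0Sn R 3)).
have p0 := pi_gt0 R.
(* The cosine term will move by at least a / 2. Within distance [b] the function [u] undoes less
   than a / 4 of it, and the linear term stays below the remaining a / 4. *)
pose b := Num.min d (Num.min m%:R^-1 (a / (4 * m%:R))).
have b0 : 0 < b by rewrite /b !lt_min d0 invr_gt0 m0' divr_gt0// mulr_gt0.
have [N Nb] : exists N : nat, pi / b < N%:R.
  by exists (Num.truncn (pi / b)).+1; rewrite truncnS_gt.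
have N0 : 0 < N%:R :> R by apply: lt_trans Nb; rewrite divr_gt0.
have pN : pi / N%:R < b by rewrite ltr_pdivrMr// mulrC -ltr_pdivrMr.
exists N => t.
have good (y : R) : t < y -> y <= t + pi / N%:R ->
    1 / 2 <= `|cos (N%:R * y) - cos (N%:R * t)| ->
    t < y < t + m%:R^-1 /\ m%:R * `|y - t| <
      `|u y + a * cos (N%:R * y) - (u t + a * cos (N%:R * t))|.
  move=> ty yt hc.
  have yb : y - t < b by lra.
  move: yb; rewrite /b !lt_min => /and3P[yd ym ya].
  split; first by apply/andP; split; lra.
  have ab : `|y - t| = y - t by rewrite gtr0_norm// subr_gt0.
  have hu : `|u y - u t| < a / 4 by apply: hd; rewrite ab.
  move: ya; rewrite ltr_pdivlMr ?mulr_gt0// => ya.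
  rewrite ab.
  have h1 : a / 2 <= `|a * (cos (N%:R * y) - cos (N%:R * t))|.
    by rewrite normrM (gtr0_norm a0) ler_pM2l//; lra.
  have h2 : `|a * (cos (N%:R * y) - cos (N%:R * t))| <=
     `|u y + a * cos (N%:R * y) - (u t + a * cos (N%:R * t))| + `|u y - u t|.
    rewrite (_ : a * (_ - _) = u y + a * cos (N%:R * y) - (u t + a * cos (N%:R * t)) -
      (u y - u t)); last by ring.
    exact: ler_normB.
  lra.
have q0 : 0 < pi / N%:R := divr_gt0 p0 N0.
set c := cos (N%:R * t); set s := sin (N%:R * t).
have cs : c ^+ 2 + s ^+ 2 = 1 by exact: cos2Dsin2.
have e1 : cos (N%:R * (t + pi / N%:R)) = - c.
  by rewrite mulrDr [N%:R * (pi / _)]mulrC divfK ?gt_eqF// cosDpi.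
have e2 : cos (N%:R * (t + pi / 2 / N%:R)) = - s.
  by rewrite mulrDr [N%:R * (pi / 2 / _)]mulrC divfK ?gt_eqF// cosDpihalf.
have q1 : pi / 2 / N%:R = pi / N%:R / 2 :> R by rewrite mulrAC.
(* Half a period moves the cosine by 2|c|. If |c| < 1/4 then |s| > 3/4, because (1/4)^2 + (3/4)^2 <
   1, and a quarter period moves it by |s + c| > 1/2. *)
have [c4|c4] := leP (1 / 4) `|c|.
  exists (t + pi / N%:R); apply: good => //; first by lra.
  rewrite e1 -/c -opprD normrN (_ : c + c = 2 * c); last by ring.
  by rewrite normrM (gtr0_norm (_ : 0 < 2)); lra.
exists (t + pi / 2 / N%:R); apply: good; [by rewrite q1; lra|by rewrite q1; lra|].
rewrite e2 -/c leNgt; apply/negP; rewrite ltr_norml => /andP[k1 k2].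
move: c4; rewrite ltr_norml => /andP[c1 c2].
have s2 : s ^+ 2 <= (3 / 4) ^+ 2.
  by rewrite -[leLHS]real_normK ?num_real// lerXn2r ?nnegrE//; rewrite ler_norml; apply/andP; split; lra.
have c22 : c ^+ 2 <= (1 / 4) ^+ 2.
  by rewrite -[leLHS]real_normK ?num_real// lerXn2r ?nnegrE//; rewrite ler_norml; apply/andP; split; lra.
by move: cs s2 c22; rewrite !expr_div_n; lra.
Qed.

End Oscillation.

(** * Boundaries of complementary components *)

Section RiemannSphere.
Variable R : realType.
Local Notation C := (Cx R).
Implicit Types (Om : set C) (w z : C).

Lemma expi_exp t N : expi t ^+ N = expi (N%:R * t) :> C.
Proof.
elim: N => [|N ih]; first by rewrite expr0 mul0r expi0.
by rewrite exprS ih -expi_add -natr1 mulrDl mul1r addrC.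
Qed.

Lemma circ_expi t : circ (expi t : C).
Proof. by rewrite /circ /= normE cmod_expi. Qed.

Lemma closureC Om w : (forall r : R, 0 < r -> exists2 z, Om z & cmod (z - w) < r) ->
  closure Om w.
Proof.
move=> h B /nbhs_cmod[r r0 hB]; have [z Oz zr] := h r r0.
by exists z; split => //; exact: hB.
Qed.

Lemma embC_connected_ray (T : set R) (f : R -> C) : connected T -> rcont f ->
  connected ((fun t => embC (f t)) @` T).
Proof.
move=> cT cf; apply: connected_continuous_connected => //.
apply: continuous_subspaceT => t; apply: (@continuous_comp _ _ _ f (@embC R)).
  exact/ccontP/cf.
exact: one_point_compactification_some_continuous.
Qed.

Lemma rcont_line (a v : C) : rcont (fun t => a + RtoC t * v).
Proof.
by move=> t; exact: cvgCD (cvgC_cst t a) (cvgCM (@rcont_RtoC R t) (cvgC_cst t v)).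
Qed.

Lemma compact_cmod_bounded (K : set C) : compact K ->
  exists M : R, forall z, K z -> cmod z < M.
Proof.
move=> /compact_near_coveringP cK.
have [M [_ hM]] : (+oo : set_system R) (fun M => K `<=` (fun z => cmod z < M)).
  apply: (cK R +oo (fun M z => cmod z < M)) => z _.
  exists ([set w | cmod (w - z) < 1], [set M : R | cmod z + 1 < M]).
    split=> /=; first by apply/nbhs_cmod; exists 1.
    by exists (cmod z + 1); split => //; exact: num_real.
  move=> [w M] /= [h1 h2]; rewrite -(subrK z w).
  by apply: le_lt_trans (cmodD _ _) _; lra.
by exists (M + 1); apply: hM; rewrite ltrDl.
Qed.

Lemma Cx_hausdorff : hausdorff_space C.
Proof.
move=> p q pq; apply/eqP; rewrite -subr_eq0 -[_ == 0]negbK -cmod_gt0; apply/negP => r0.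
have [||x [/= h1 h2]] := pq [set x | cmod (x - p) < cmod (p - q) / 2]
    [set x | cmod (x - q) < cmod (p - q) / 2].
- by apply/nbhs_cmod; exists (cmod (p - q) / 2); rewrite ?divr_gt0.
- by apply/nbhs_cmod; exists (cmod (p - q) / 2); rewrite ?divr_gt0.
by have := cmodD3 p x q; rewrite [cmod (p - x)]cmodB; lra.
Qed.

(** Squares instead of discs: they are images of products of segments, which gives compactness, and
    they are what neighbourhoods of infinity are compared with. *)
Definition csquare (M : R) : set C :=
  [set z | `|complex.Re z| <= M /\ `|complex.Im z| <= M].

Lemma csquare_compact M : compact (csquare M).
Proof.
have -> : csquare M =
    (fun p : R * R => (p.1 +i* p.2)%C : C) @` (`[- M, M] `*` `[- M, M]).
  apply/seteqP; split=> [[x y] [/= h1 h2]|_ [[x y] [/= h1 h2] <-]].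
    by exists (x, y) => //=; rewrite !in_itv /= -!ler_norml.
  by move: h1 h2; rewrite !in_itv /= -!ler_norml.
apply: continuous_compact; last by apply: compact_setX; exact: segment_compact.
apply: continuous_subspaceT => p; apply/ccontP => e e0.
have e2 : 0 < e / 2 by rewrite divr_gt0.
exists (ball p.1 (e / 2), ball p.2 (e / 2)); first by split; exact: nbhsx_ballx.
move=> [x y] /=; rewrite -!ball_normE /ball_/= => -[h1 h2].
apply: le_lt_trans (cmod_ReIm _) _; rewrite cxReD cxImD cxReN cxImN /=.
by rewrite (distrC x) (distrC y); lra.
Qed.

Section Boundary.
Variables (Om : set C) (p : Chat R).
Hypotheses (oOm : open Om) (bOm : bounded_set Om).
Let X : set (Chat R) := ~` (@embC R @` Om).
Let V := connected_component X p.

Lemma bounded_cmod : exists M : R, forall z, Om z -> cmod z <= M.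
Proof.
move: bOm => [M [Mr hM]].
have := hM (RtoC (cmod M + 1)); rewrite /globally /=.
have -> : M < RtoC (cmod M + 1).
  apply: (@le_lt_trans _ _ `|M|); first exact: real_ler_norm.
  by rewrite normE RtoC_lt ltrDl.
move=> /(_ erefl) h; exists (cmod M + 1) => z Oz.
by have := h z Oz; rewrite normE RtoC_le.
Qed.

Lemma component_max (N : set (Chat R)) q : V q -> N q -> N `<=` X ->
  connected N -> N `<=` V.
Proof.
move=> Vq Nq NX cN; rewrite /V (same_connected_component Vq).
exact: connected_component_max.
Qed.

Lemma closed_X : closed X.
Proof.
apply: (@open_closedC (Chat R)); exact: one_point_compactification_open_some oOm.
Qed.

(** If a disc around a finite point of [V] misses [Om], segments to the centre put the whole disc
    into [V], so the point is interior. Infinity, if it belongs to [V], is always interior: outside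
    a large square every point is joined to infinity by a ray that misses the bounded set [Om]. *)
Lemma component_bdry q : V q -> closure (~` V) q ->
  exists2 w, q = Some w & closure Om w.
Proof.
case: q => [w|] Vq cq.
  exists w => //; apply: closureC => r r0; apply: contrapT => no.
  have noO x : cmod (x - w) < r -> ~ Om x by move=> xr Ox; apply: no; exists x.
  pose seg x := (fun t => embC (w + RtoC t * (x - w))) @` `[0, 1]%classic.
  have segV x : cmod (x - w) < r -> seg x `<=` V.
    move=> xr; apply: (component_max Vq).
    - by exists 0; rewrite /= ?in_itv/= ?lexx ?ler01// RtoC0 mul0r addr0.
    - move=> q [t /=]; rewrite in_itv /= => /andP[t0 t1] <- [y Oy [ye]].
      apply: (noO y) => //; rewrite ye addrC addKr cmodM cmodRtoC ger0_norm//.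
      by apply: le_lt_trans xr; rewrite -[leRHS]mul1r ler_wpM2r// cmod_ge0.
    - apply: embC_connected_ray; last exact: rcont_line.
      exact: segment_connected.
  have [|q [nV [x xr qe]]] := cq (@embC R @` [set x | cmod (x - w) < r]).
    apply: one_point_compactification_some_nbhs.
    by apply/nbhs_cmod; exists r.
  apply: nV; rewrite -qe; apply: (segV x xr); exists 1; first by rewrite /= in_itv/= ler01 lexx.
  by rewrite RtoC1 mul1r subrKC.
exfalso.
have [M0 hM0] := bounded_cmod.
pose M := Num.max M0 0.
have hM z : Om z -> csquare M z.
  move=> Oz; have zM : cmod z <= M by rewrite le_max hM0.
  by split; [exact: le_trans (cmod_Re z) zM|exact: le_trans (cmod_Im z) zM].
have cM := @csquare_compact M.
have [|[x|] [nV xN]] := cq ((@embC R @` (~` csquare M)) `|` [set infty R]).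
- exists (csquare M) => //; split => //; exact: compact_closed Cx_hausdorff cM.
- apply: nV.
  have nx : ~ csquare M x by case: xN => [[y ny [<-]]//|].
  (* The ray starts at [x] and moves away from the origin; both coordinates grow in absolute value,
     so it never enters the square. *)
  pose A := (fun t => embC (0 + RtoC t * x)) @` `[1, +oo[%classic.
  have AX : A `<=` X.
    move=> q [t /=]; rewrite in_itv /= andbT => t1 <- [y Oy [ye]].
    apply: nx; have := hM y Oy; rewrite ye add0r => -[h1 h2].
    have t0 : 0 <= t by lra.
    rewrite cxReM cxImM /= !mul0r subr0 addr0 !normrM (ger0_norm t0) in h1 h2.
    by split; [apply: le_trans h1|apply: le_trans h2]; rewrite -[leLHS]mul1r ler_wpM2r.
  have cA : connected A.
    by apply: embC_connected_ray; [exact/connected_intervalP/interval_is_interval|exact: rcont_line].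
  (* The closure is taken to pick up infinity, the point already known to be in [V]. It stays
     connected, and it stays in [X] because [X] is closed. *)
  have : closure A `<=` V.
    apply: (component_max Vq).
    + move=> B [K [cK clK] KB].
      have [L hL] := compact_cmod_bounded cK.
      have x0 : 0 < cmod x.
        rewrite cmod_gt0; apply/eqP => xe; apply: nx; rewrite xe.
        by split; rewrite /= normr0 le_max lexx orbT.
      pose t := Num.max 1 (L / cmod x).
      exists (embC (0 + RtoC t * x)); split.
        by exists t => //; rewrite /= in_itv /= andbT le_max lexx.
      apply: KB; left; exists (0 + RtoC t * x) => // /hL.
      have t0 : 0 <= t by rewrite le_max ler01.
      rewrite add0r cmodM cmodRtoC ger0_norm// -ltr_pdivlMr// ltNge.
      by rewrite le_max lexx orbT.
    + have := closed_X; rewrite closure_id => XE.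
      by rewrite XE; exact: closure_subset.
    + exact: connected_closure.
  apply; apply: subset_closure; exists 1; first by rewrite /= in_itv /= lexx.
  by rewrite RtoC1 mul1r add0r.
- exact: nV.
Qed.

End Boundary.
End RiemannSphere.

(** * Boundary values and inverses of the Riemann maps *)

Section RiemannData.
Variable R : realType.
Local Notation C := (Cx R).
Local Notation tau := (pi *+ 2 : R).
Variables (Om : set C) (p : Chat R) (phi : C -> Chat R).
Hypotheses (oOm : open Om) (bOm : bounded_set Om).
Let V := connected_component (~` (@embC R @` Om)) p.
Hypothesis rphi : riemann_map (~` V) phi.

Lemma cdiskE (z : C) : cdisk z <-> cmod z <= 1.
Proof. by rewrite /cdisk /= normE -[1]/(RtoC 1) RtoC_le. Qed.

Lemma odiskE (z : C) : odisk z <-> cmod z < 1.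
Proof. by rewrite /odisk /= normE -[1]/(RtoC 1) RtoC_lt. Qed.

Lemma circE (z : C) : circ z <-> cmod z = 1.
Proof.
by rewrite /circ /= normE -[1]/(RtoC 1); split=> [/RtoC_inj|->].
Qed.

Lemma Om_compl w : Om w -> (~` V) (Some w).
Proof. by move=> Ow /connected_component_sub; apply; exists w. Qed.

Lemma closure_Om_compl w : closure Om w -> closure (~` V) (Some w).
Proof.
move=> cw B nB; have [x [Ox Bx]] := cw (fun x => B (Some x)) nB.
by exists (Some x); split => //; exact: Om_compl.
Qed.

(** By injectivity phi z is not in phi (odisk), the complement of [V]; but it is in the closure of
    that complement. So it is a boundary point of [V], and [component_bdry] applies. *)
Lemma phi_circ z : circ z -> exists2 w, phi z = Some w & closure Om w.
Proof.
case: rphi => -[_ phi_inj phi_cl _] [phi_o _] /circE cz.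
have zc : cdisk z by apply/cdiskE; rewrite cz.
apply: (component_bdry oOm bOm (p := p)).
  apply: contrapT => nV; have : (~` V) (phi z) by [].
  rewrite -phi_o => -[z' /odiskE oz' e].
  have zz' : z' = z by apply: phi_inj => //; apply/cdiskE; exact: ltW.
  by move: oz'; rewrite zz' cz ltxx.
by rewrite -/V -phi_cl; exists z.
Qed.

(** The boundary curve of [V] as a curve in the plane. The default value of [fhat] at infinity never
    occurs, by [phi_circ]. *)
Definition bparam (t : R) : C := fhat id (phi (expi t)).

Lemma bparamP t : phi (expi t) = Some (bparam t) /\ closure Om (bparam t).
Proof. by rewrite /bparam; have [w -> cw] := phi_circ (circ_expi t). Qed.

Lemma fhat_within f : algA Om f -> forall z, circ z -> forall e : R, 0 < e ->
  \forall z' \near z, circ z' -> cmod (fhat f (phi z') - fhat f (phi z)) < e.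
Proof.
move=> /algAP[cf _] z cz e e0; have [w pw cw] := phi_circ cz.
have [r r0 hr] := cf w cw e e0.
case: rphi => -[/subspace_continuousP cphi _ _ _] _.
have zc : cdisk z by apply/cdiskE; move/circE: cz => ->.
pose Q : set (Chat R) := [set q | if q is Some x then cmod (x - w) < r else False].
have nQ : nbhs (phi z) Q by rewrite pw; apply/nbhs_cmod; exists r.
have : nbhs z (fun z' => cdisk z' -> Q (phi z')) by exact: (cphi z zc Q nQ).
apply: filterS => z' hz' cz'.
have [x px cx] := phi_circ cz'; have : Q (phi z').
  by apply: hz'; apply/cdiskE; move/circE: cz' => ->.
by rewrite px pw /= => xr; exact: hr.
Qed.

Lemma bparam_rcont f : algA Om f -> rcont (fun t => f (bparam t)).
Proof.
move=> fA t e e0; have := fhat_within fA (circ_expi t) e0.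
move=> /nbhs_cmod[r r0 hr].
apply: filterS (@ccont_expi R t r r0) => s /hr /(_ (circ_expi s)).
by rewrite (bparamP s).1 (bparamP t).1.
Qed.

Lemma bparam_tau t : bparam (t + tau) = bparam t.
Proof. by rewrite /bparam expi_add expi_tau mulr1. Qed.

Lemma EkP f m : algA Om f ->
  Ek phi m f <-> osc m (fun t => complex.Re (f (bparam t))).
Proof.
move=> fA; rewrite /Ek /Dk.
have E t : complex.Re (fhat f (phi (expi t))) = complex.Re (f (bparam t)).
  by rewrite (bparamP t).1.
split=> [[_ h] t|h].
  by have [y [yt hy]] := h t; exists y; split => //; rewrite -!E.
split.
  apply/subspace_continuousP => z cz; apply/cvgrPdist_lt => e e0.
  have := fhat_within fA cz e0; apply: filterS => z' h' cz'.
  by apply: le_lt_trans (h' cz'); rewrite distrC -cxReN -cxReD cmod_Re.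
by move=> t; have [y [yt hy]] := h t; exists y; split => //; rewrite !E.
Qed.

Lemma bparam_Re_cont f : algA Om f -> continuous (fun t => complex.Re (f (bparam t))).
Proof. by move=> fA t; apply: ccont_Re; exact: bparam_rcont. Qed.

Lemma Ek_open m : A_open Om (Ek phi m).
Proof.
move=> f fA /(EkP m fA) of_.
have [|e e0 he] := osc_robust (bparam_Re_cont fA) _ of_.
  by move=> t; rewrite bparam_tau.
exists e => // g gA /supdistP fg; apply/(EkP m gA); apply: he => t.
rewrite -cxReN -cxReD; apply: le_trans (cmod_Re _) _; rewrite cmodB.
by apply: fg; exact: (bparamP t).2.
Qed.

(** The given coordinate may be the one at infinity although the value is finite. Then h z0 is not
    0, because [chat_inv] sends 0 to infinity, and 1 / h is a finite coordinate. *)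
Lemma holo_chat_cdiff (z0 w0 : C) : phi z0 = Some w0 -> holo_chat_at phi z0 ->
  exists2 h : C -> C, (\forall z \near z0, phi z = Some (h z)) &
    exists2 r : R, 0 < r & forall z, cmod (z - z0) < r -> exists d, cdiff h z d.
Proof.
move=> pz0 [h [dh []]] ph.
  exists h => //; have /nbhs_cmod[r r0 hr] := dh.
  by exists r => // z /hr /derivable_cdiff.
have dh' : \forall z \near z0, exists d, cdiff h z d.
  by apply: filterS dh => z /derivable_cdiff.
have hz0 : h z0 != 0.
  by have := nbhs_singleton ph; rewrite pz0 /=; case: eqP.
have [d0 /cdiff_continuous ch] := nbhs_singleton dh'.
have hn0 : \forall z \near z0, h z != 0.
  apply: filterS (ch (cmod (h z0)) _) => [z|]; last by rewrite cmod_gt0.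
  by apply: contraTneq => ->; rewrite sub0r cmodN ltxx.
exists (fun z => (h z)^-1).
  by apply: filterS2 ph hn0 => z -> hz /=; rewrite (negbTE hz).
have /nbhs_cmod[r r0 hr] : \forall z \near z0, exists d, cdiff (fun z => (h z)^-1) z d.
  by apply: filterS2 dh' hn0 => z [d dd] hz; eexists; exact: cdiffV dd.
by exists r.
Qed.

(** The function is [psi] on finite points. At a point of [Om] the map phi has a finite holomorphic
    coordinate [h]; there [k] inverts [h] on both sides, the right inverse coming from the openness
    of [Om], so [cdiff_inverse] applies. *)
Lemma riemann_inverse : exists k : C -> C,
  [/\ algA Om k, (forall z, closure Om z -> cmod (k z) <= 1),
      (forall z, Om z -> cmod (k z) < 1) & forall t, k (bparam t) = expi t].
Proof.
case: (rphi) => -[_ phi_inj phi_cl [psi [/within_cmod cpsi psiK]]] [phi_o phi_h].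
pose k w := psi (Some w).
have kcl w : closure Om w -> exists2 z, cdisk z & phi z = Some w /\ k w = z.
  move=> /closure_Om_compl; rewrite -phi_cl => -[z cz e].
  by exists z => //; split => //; rewrite /k -e psiK.
have kO w : Om w -> exists2 z, odisk z & phi z = Some w /\ k w = z.
  move=> /Om_compl; rewrite -phi_o => -[z oz e]; exists z => //; split => //.
  by rewrite /k -e psiK//; apply/cdiskE/ltW/odiskE.
have ck : wcont (closure Om) k.
  move=> w cw e e0.
  have /nbhs_cmod[r r0 hr] : \forall x \near w, closure (~` V) (Some x) ->
      cmod (k x - k w) < e by exact: cpsi (closure_Om_compl cw) e e0.
  by exists r => // x cx /hr; apply; exact: closure_Om_compl.
exists k; split.
- apply/algAP; split => // w0 Ow0.
  have [z0 oz0 [pz0 kw0]] := kO w0 Ow0.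
  have [h ph [r r0 dh]] := holo_chat_cdiff pz0 (phi_h z0 oz0).
  have nO : \forall z \near z0, odisk z.
    apply/nbhs_cmod; exists (1 - cmod z0); first by rewrite subr_gt0; exact/odiskE.
    move=> z zr; apply/odiskE; rewrite -(subrK z0 z).
    by apply: le_lt_trans (cmodD _ _) _; lra.
  have /nbhs_cmod[r1 r10 h1] : \forall z \near z0, phi z = Some (h z) /\ odisk z.
    by apply: filterS2 ph nO => z.
  have hz0 : h z0 = w0.
    by have [] := h1 z0; rewrite ?subrr ?cmod0// pz0 => -[].
  pose r' := Num.min r r1.
  have r'0 : 0 < r' by rewrite lt_min r0.
  have dh' z : cmod (z - z0) < r' -> exists d, cdiff h z d.
    by rewrite lt_min => /andP[/dh].
  have kh z : cmod (z - z0) < r' -> k (h z) = z.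
    rewrite lt_min => /andP[_ /h1[pz oz]]; rewrite /k -pz psiK//.
    by apply/cdiskE/ltW/odiskE.
  have nOm : nbhs w0 Om by exact: open_nbhs_nbhs.
  have ckw0 : ccont k (h z0).
    rewrite hz0 => e e0.
    have [s s0 hs] := ck w0 (subset_closure Ow0) e e0.
    have ns : nbhs w0 [set x | cmod (x - w0) < s] by apply/nbhs_cmod; exists s.
    by apply: filterS2 nOm ns => x Ox; apply: hs; exact: subset_closure.
  have [d dd] := dh z0 ltac:(by rewrite subrr cmod0).
  rewrite -hz0; exists d^-1; apply: (cdiff_inverse r'0 dh' kh ckw0 dd).
  have nk := ckw0 r' r'0; rewrite hz0 in nk *.
  apply: filterS2 nOm nk => x Ox; rewrite kw0 lt_min => /andP[_ /h1[pk _]].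
  have [z oz [pz kx]] := kO x Ox.
  by move: pk; rewrite kx pz => -[].
- by move=> w /kcl[z /cdiskE cz [_ ->]].
- by move=> w /kO[z /odiskE cz [_ ->]].
- move=> t; rewrite /k -(bparamP t).1 psiK//.
  by apply/cdiskE; rewrite cmod_expi.
Qed.

Lemma Ek_dense_step k m f (a : R) : algA Om k -> (forall t, k (bparam t) = expi t) ->
  algA Om f -> (0 < m)%N -> 0 < a ->
  exists N, Ek phi m (fun z => f z + RtoC a * k z ^+ N).
Proof.
move=> kA kb fA m0 a0.
have [|N oN] := @osc_add_cos R m _ a m0 (bparam_Re_cont fA) _ a0.
  by move=> t; rewrite bparam_tau.
exists N; apply/EkP; first exact: algA_addX.
have -> : (fun t => complex.Re (f (bparam t) + RtoC a * k (bparam t) ^+ N)) =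
    (fun t => complex.Re (f (bparam t)) + a * cos (N%:R * t)); last by [].
by apply/funext => t; rewrite kb expi_exp cxReD cxReM /= mul0r subr0.
Qed.

End RiemannData.

(** * Enumeration of the open conditions and conclusion *)

Theorem theorem4p2 (R : realType) (n : nat) (Om : set (Cx R))
    (V : nat -> set (Chat R)) (phi : nat -> Cx R -> Chat R) :
  open Om -> connected Om -> Om !=set0 -> bounded_set Om ->
  (exists J : nat -> set (Cx R),
     [/\ (forall i, (i < n)%N -> jordan_curve (J i)),
         (forall i j, (i < n)%N -> (j < n)%N -> i <> j -> J i `&` J j = set0) &
         bdry Om = \bigcup_(i in [set i | (i < n)%N]) J i]) ->
  (forall i, (i < n)%N ->
     exists2 p, (~` (@embC R @` Om)) p &
       V i = connected_component (~` (@embC R @` Om)) p) ->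
  (forall i j, (i < n)%N -> (j < n)%N -> V i = V j -> i = j) ->
  (forall p, (~` (@embC R @` Om)) p -> exists2 i, (i < n)%N & V i p) ->
  V 0%N (infty R) ->
  (forall i, (i < n)%N -> riemann_map (~` V i) (phi i)) ->
  let S := [set f | algA Om f /\
                    forall i k, (i < n)%N -> (0 < k)%N -> Ek (phi i) k f] in
  S `<=` algA Om /\ A_dense Om S /\ A_Gdelta Om S.
Proof.
move=> oOm _ _ bOm _ Vcomp _ Vcover _ rphi S; split; first by move=> f [].
(* This provides an index below [n], used as a dummy wherever the perturbation is 0. *)
have [i0 i0n _] : exists2 i, (i < n)%N & V i (infty R).
  by apply: Vcover => -[z _].
have data i : exists k : Cx R -> Cx R, (i < n)%N ->
    [/\ algA Om k, (forall z, closure Om z -> cmod (k z) <= 1),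
      (forall z, Om z -> cmod (k z) < 1) & forall m f (a : R), algA Om f ->
      (0 < m)%N -> 0 < a -> exists N, Ek (phi i) m (fun z => f z + RtoC a * k z ^+ N)].
  have [ilt|] := ltnP i n; last by exists (fun=> 0).
  have [p _ Vi] := Vcomp i ilt; have ri := rphi i ilt; rewrite Vi in ri.
  have [k [kA k1 k2 kb]] := riemann_inverse oOm bOm ri.
  exists k => _; split => // m f a fA m0 a0.
  exact: (Ek_dense_step oOm bOm ri kA kb).
have Eopen i m : (i < n)%N -> A_open Om (Ek (phi i) m).
  move=> ilt; have [p _ Vi] := Vcomp i ilt; have := rphi i ilt; rewrite Vi.
  by move=> ri; exact: (Ek_open oOm bOm ri).
have [k kP] := choice data.
(* The pairs (i, k) are enumerated by their codes. Codes of no pair, or of a pair outside the range,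
   impose no condition; k = 0 has to be excluded, since 0^-1 = 0 leaves an empty window in [Dk]. *)
pose T (j : nat) : set (Cx R -> Cx R) := [set f |
  if @unpickle (nat * nat)%type j is Some im then
    (im.1 < n)%N -> (0 < im.2)%N -> Ek (phi im.1) im.2 f else True].
have ST f : algA Om f -> S f <-> forall j, T j f.
  move=> fA; split=> [[_ h] j|h].
    by rewrite /T /=; case: unpickle => // -[i m] /=; exact: h.
  split => // i m ilt m0; have := h (pickle (i, m)); rewrite /T /= pickleK /=.
  exact.
have oT j : A_open Om (T j).
  rewrite /T; case: unpickle => [[i m] /=|]; last by move=> f _ _; exists 1.
  have [ilt|ilt] := ltnP i n; last first.
    by move=> f _ _; exists 1 => // g _ _; rewrite ltnNge ilt.
  have [m0|m0] := posnP m; first by move=> f _ _; exists 1 => // g _ _; rewrite m0.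
  move=> f fA Tf; have Ef : Ek (phi i) m f by exact: Tf.
  have [e e0 he] := Eopen i m ilt f fA Ef.
  by exists e => // g gA fg _ _; exact: he.
split; last by exists T.
move=> f fA e e0.
have [||||g [gA Tg fg]] := @dense_bigcap R Om n k oOm _ _ _ T oT _ f e fA e0.
- by move=> i /kP[].
- by move=> i /kP[].
- by move=> i /kP[].
(* For a code without condition the coefficient 0 is taken; otherwise the full amplitude [a] is
   used, with the frequency found by [Ek_dense_step]. *)
- move=> j g a gA a0; rewrite /T; case: unpickle => [[i m] /=|]; last first.
    by exists i0, 0%N, 0; split => //; rewrite lexx ltW.
  have [/andP[ilt m0]|] := boolP ((i < n) && (0 < m))%N; last first.
    move=> im; exists i0, 0%N, 0; split => //; first by rewrite lexx ltW.
    by move=> ilt m0; move: im; rewrite ilt m0.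
  have [_ _ _ dk] := kP i ilt; have [N EN] := dk m g a gA m0 a0.
  by exists i, N, a; split => //; rewrite lexx ltW.
by exists g; split => //; exact/(ST g gA).
Qed.
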